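(* Let $\Theta\subset\mathbb{R}^d$ be compact. With $\varepsilon_\theta=Y-\theta'Z$, put $$\Psi(\theta,\eta,\rho)=P[\rho(\varepsilon_\theta,\theta)\{Z-\eta(\varepsilon_\theta,\theta)\}\Delta],$$ $$\Psi_n(\theta,\eta,\rho)=\frac1n\sum_{i=1}^n\Omega_i\,\rho(Y_i-\theta'Z_i,\theta)\{Z_i-\eta(Y_i-\theta'Z_i,\theta)\}\Delta_i ,$$ $$\eta_0(t,\theta)=\frac{E\{1(Y-\theta'Z\ge t)Z\}}{E\{1(Y-\theta'Z\ge t)\}},$$ and let $\rho_0(t,\theta)$ be a fixed real-valued weight function. Assume that $\theta_0\in\Theta$ is the unique solution in $\Theta$ of $\Psi(\theta,\eta_0(\cdot,\theta),\rho_0(\cdot,\theta))=0$. Let $\|\cdot\|$ be the supremum norm. Let $\eta=\eta_n$ and $\rho=\rho_n$ (possibly depending on the data) satisfy $\|\eta-\eta_0\|\le\delta_n$ and $\|\rho-\rho_0\|\le\delta_n$ with $\delta_n\downarrow0$, where $\eta,\eta_0,\rho,\rho_0$ belong to Glivenko–Cantelli classes and are bounded. Then: (i) In outer probability, $\|\Psi_n(\theta,\eta,\rho)-\Psi(\theta,\eta_0,\rho_0)\|\to0$ (supremum over $\theta\in\Theta$). (ii) An approximate root $\hat\theta_n\in\Theta$ satisfying $\Psi_n(\hat\theta_n,\eta(\cdot,\hat\theta_n),\rho(\cdot,\hat\theta_n))=o_{p^*}(1)$ is consistent for $\theta_0$. (iii) When $$\hat\eta_n(t,\theta)=\frac{\sum_{j=1}^nW_j1(Y_j-\theta'Z_j\ge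 t)Z_j}{\sum_{j=1}^nW_j1(Y_j-\theta'Z_j\ge t)},\qquad \hat\rho_n(t,\theta)=\frac{\sum_{j=1}^nW_j1(Y_j-\theta'Z_j\ge t)}{\sum_{j=1}^nW_j},$$ and $\rho_0(t,\theta)=\Pr(Y-\theta'Z\ge t)$, an approximate root $\hat\theta_n\in\Theta$ satisfying $\Psi_n(\hat\theta_n,\hat\eta_n(\cdot,\hat\theta_n),\hat\rho_n(\cdot,\hat\theta_n))=o_{p^*}(1)$ is consistent for $\theta_0$.
   Context: Model. $T_i=\theta_0'Z_i+e_i$, $i=1,\dots,n$, where $T_i$ is a (monotonically transformed) failure time, $Z_i\in\mathbb{R}^d$ is a covariate vector, and the $e_i$ are i.i.d. with unknown distribution $F$, with $e_i$ independent of $(Z_i,C_i)$; $C_i$ is the transformed censoring time. Put $Y_i=\min(T_i,C_i)$, $\Delta_i=1(T_i\le C_i)$, $X_i=(Y_i,\Delta_i,Z_i)$. A prime denotes transpose. Write $Z_i=(Z_{1i}',Z_{2i}')'$; $Z_{2i},Y_i,\Delta_i$ are always observed, $R_i\in\{0,1\}$ indicates that $Z_{1i}$ is observed, and $Z_{1i}$ is missing at random: $\pi_i=\Pr(R_i=1\mid Z_i,Y_i,\Delta_i)=\Pr(R_i=1\mid Z_{2i},Y_i,\Delta_i)$. Weights. $\Omega_i$ and $W_i$ are subject-specific weights (possibly different, possibly depending on $\Delta_i$ and $R_i$); they are bounded and satisfy $E(\Omega_i\mid X_i)=E(W_i\mid X_i)=1$. The vectors $(X_i,R_i,\Omega_i,W_i)$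 are i.i.d. copies of $(X,R,\Omega,W)$, $X=(Y,\Delta,Z)$. $P$ denotes expectation under the law of one observation: $Pf=\int f\,dP$, where a data-dependent function is treated as fixed in the integral. Standing regularity conditions. (1) $Z$ is bounded. (2) The error density $f$ of $F$ and its derivative $f'$ exist and are bounded, and $\int (f'/f)^2 f\,dt<\infty$. (3) The conditional density of the censoring time $C$ given $Z$ is uniformly bounded. (A) There are constants $\tau<\infty$ and $\xi$ with $\Pr(Y-\theta'Z\ge\tau\mid Z)\ge\xi>0$ for all $Z$ and all $\theta\in\Theta$. (B) $\Pr(R=1\mid Z_2,Y,\Delta)\ge\zeta>0$ for all $Z_2,Y,\Delta$, for some constant $\zeta$. Conventions. $\eta(t,\theta)$ takes values in $\mathbb{R}^d$ and $\rho(t,\theta)$ in $\mathbb{R}$; for functions of $(t,\theta)$, $\|g\|=\sup_{t,\ \theta\in\Theta}|g(t,\theta)|$. ''$\eta$ belongs to a Glivenko–Cantelli class'' means that the functions $(y,z)\mapsto\eta(y-\theta'z,\theta)$, $\theta\in\Theta$, lie (componentwise) in a fixed $P$-Glivenko–Cantelli class of functions; similarly for $\eta_0,\rho,\rho_0$. $\Psi(\theta,\eta_0,\rho_0)$ abbreviates $\Psi(\theta,\eta_0(\cdot,\theta),\rho_0(\cdot,\theta))$, and similarly for $\Psi_n$. $o_{p^*}(1)$ means convergence to zero in outer probability; consistency means $|\hat\theta_n-\theta_0|\to0$ in outer probability. $0/0$ is read as $0$.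
   Formalization: Part (ii) is proved under the added assumption that θ ↦ Ψ(θ,η0,ρ0) is continuous on Θ; without it (ii) fails, since for a ρ0 discontinuous in θ the unique root need not be separated from near-zeros of Ψ elsewhere in Θ. *)

(* Defs.v *)
From HB Require Import structures.
From mathcomp Require Import all_boot all_order all_algebra.
From mathcomp Require Import all_classical all_reals all_analysis.

Set Implicit Arguments.
Unset Strict Implicit.
Unset Printing Implicit Defensive.

Import Order.TTheory GRing.Theory Num.Theory.
Import numFieldNormedType.Exports.

Local Open Scope classical_set_scope.
Local Open Scope ring_scope.

(* The sigma-algebra on row vectors generated by the coordinates, i.e. the
   Borel sets of R^n; it mirrors the library's one on n-tuples. *)
Section measurable_rV.
Variables (R : realType) (n : nat).

Definition rV_measurable : set (set 'rV[R]_n) :=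
  g_sigma_preimage (fun (j : 'I_n) (v : 'rV[R]_n) => v ord0 j).

Definition rV_display : measure_display.
Proof. exact: default_measure_display. Qed.

Let rV0 : rV_measurable set0.
Proof. exact: sigma_algebra0. Qed.

Let rVC A : rV_measurable A -> rV_measurable (~` A).
Proof. exact: sigma_algebraC. Qed.

Let rV_bigcup (F : (set 'rV[R]_n)^nat) :
  (forall i, rV_measurable (F i)) -> rV_measurable (\bigcup_i (F i)).
Proof. exact: sigma_algebra_bigcup. Qed.

HB.instance Definition _ :=
  @isMeasurable.Build rV_display 'rV[R]_n rV_measurable rV0 rVC rV_bigcup.

End measurable_rV.

Section probability_notions.
Context d (T : measurableType d) (R : realType) (P : probability T R).

Definition same_law d1 (T1 : measurableType d1) (P1 : probability T1 R)
    dS (S : measurableType dS) (X1 : T1 -> S) (X : T -> S) :=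
  forall A, measurable A -> P1 (X1 @^-1` A) = P (X @^-1` A).

Definition independent2 dS (S : measurableType dS) dS' (S' : measurableType dS')
    (X : T -> S) (X' : T -> S') :=
  forall A B, measurable A -> measurable B ->
    P (X @^-1` A `&` X' @^-1` B) = (P (X @^-1` A) * P (X' @^-1` B))%E.

(* The product rule for initial segments gives it for every finite subfamily,
   since any A i may be the whole space. *)
Definition independent_seq dS (S : measurableType dS) (X : nat -> T -> S) :=
  forall (n : nat) (A : nat -> set S), (forall i, measurable (A i)) ->
    P (\bigcap_(i < n) (X i @^-1` A i)) = (\prod_(i < n) P (X i @^-1` A i))%E.

Definition iid dS (S : measurableType dS) (X : nat -> T -> S) :=
  [/\ forall i, measurable_fun setT (X i), independent_seq X
    & forall i, same_law P (X i) (X 0%N)].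

(* g (X) is a version of E (V | X) *)
Definition is_cond_exp dS (S : measurableType dS)
    (X : T -> S) (V : T -> R) (g : S -> R) :=
  [/\ measurable_fun setT g,
      P.-integrable setT (fun w => (V w)%:E),
      P.-integrable setT (fun w => (g (X w))%:E)
    & forall B, measurable B ->
        (\int[P]_(w in X @^-1` B) (V w)%:E
         = \int[P]_(w in X @^-1` B) (g (X w))%:E)%E].

Definition is_density (X : T -> R) (f : R -> R) :=
  [/\ measurable_fun setT f, forall t, 0 <= f t
    & forall A, measurable A ->
        P (X @^-1` A) = (\int[lebesgue_measure]_(t in A) (f t)%:E)%E].

(* g z is a density of the conditional law of X given Z = z *)
Definition is_cond_density dS (S : measurableType dS)
    (X : T -> R) (Z : T -> S) (g : S -> R -> R) :=
  [/\ measurable_fun setT (fun p : S * R => g p.1 p.2),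
      forall z t, 0 <= g z t
    & forall A B, measurable A -> measurable B ->
        P (X @^-1` A `&` Z @^-1` B)
        = (\int[P]_(w in Z @^-1` B)
             \int[lebesgue_measure]_(t in A) (g (Z w) t)%:E)%E].

(* [mu_ext P] is the outer probability P^*; no measurability of D is needed. *)
Definition cvg0_outer (D : nat -> T -> \bar R) :=
  forall e : R, 0 < e ->
    (fun n => mu_ext P [set w | (e%:E < D n w)%E]) @ \oo --> 0%E.

End probability_notions.

(* F is a Glivenko-Cantelli class for the law of V under P.  The property
   belongs to the class and the law, not to a particular sample, so the uniform
   law of large numbers is required of every i.i.d. sequence with that law, on
   whatever probability space (this is the same as requiring it of the
   coordinate projections of the infinite product space, the general case
   following by pulling measurable covers back). *)
Definition glivenko_cantelli d (T : measurableType d) (R : realType)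
    (P : probability T R) dS (S : measurableType dS) (V : T -> S)
    (F : set (S -> R)) :=
  (forall f, F f -> measurable_fun setT f /\
     P.-integrable setT (fun w => (f (V w))%:E)) /\
  (forall d' (T' : measurableType d') (P' : probability T' R)
     (X : nat -> T' -> S), iid P' X -> same_law P P' (X 0%N) V ->
     cvg0_outer P' (fun n w => ereal_sup
       [set (`|n%:R^-1 * (\sum_(i < n) f (X i w)) - \int[P]_v f (V v)|)%:E
         | f in F])).

Definition dotp (R : realType) n (u v : 'rV[R]_n) : R :=
  \sum_j u ord0 j * v ord0 j.

(* On R^p the norm of the library is the maximum norm; being equivalent to the
   Euclidean one, it gives the same notions of boundedness and convergence. *)
Definition supnorm (R : realType) (p : nat) (V : normedZmodType R)
    (Theta : set 'rV[R]_p) (g : R -> 'rV[R]_p -> V) : \bar R :=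
  ereal_sup [set (`|g x.1 x.2|)%:E | x in [set: R] `*` Theta].

(* Z = (Z1, Z2) with Z1 of dimension d1 and Z2 = rsubmx Z of dimension d2 *)
Record aft_sample d (T : measurableType d) (R : realType) (P : probability T R)
    (d1 d2 : nat) := AftSample {
  failt : nat -> {RV P >-> R};
  err : nat -> {RV P >-> R};
  cens : nat -> {RV P >-> R};
  covz : nat -> {RV P >-> 'rV[R]_(d1 + d2)};
  rind : nat -> {RV P >-> bool};
  wOmega : nat -> {RV P >-> R};
  wW : nat -> {RV P >-> R} }.

Section aft.
Context d (T : measurableType d) (R : realType) (P : probability T R).
Context (d1 d2 : nat).
Local Notation vec := 'rV[R]_(d1 + d2).
Variable s : aft_sample P d1 d2.
Implicit Types (theta : vec) (i n : nat) (w : T).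
Implicit Types (eta : R -> vec -> vec) (rho : R -> vec -> R).

Definition obsY i w : R := Num.min (failt s i w) (cens s i w).

Definition obsD i w : bool := failt s i w <= cens s i w.

Definition resid theta i w : R := obsY i w - dotp theta (covz s i w).

Definition at_risk (t : R) theta i w : bool := t <= resid theta i w.

Definition obsX i w : R * bool * vec := (obsY i w, obsD i w, covz s i w).

Definition obs_full i w : R * bool * vec * bool * R * R :=
  (obsX i w, rind s i w, wOmega s i w, wW s i w).

Definition obs_always i w : R * bool * 'rV[R]_d2 :=
  (obsY i w, obsD i w, rsubmx (covz s i w)).

Definition always_part (x : R * bool * vec) : R * bool * 'rV[R]_d2 :=
  (x.1, rsubmx x.2).

Definition aft_model (theta0 : vec) :=
  [/\ forall i w, failt s i w = dotp theta0 (covz s i w) + err s i w,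
      iid P (err s),
      forall i, independent2 P (err s i) (fun w => (covz s i w, cens s i w))
    & iid P obs_full].

Definition missing_at_random :=
  forall i, exists pi : R * bool * 'rV[R]_d2 -> R,
    is_cond_exp P (obsX i) (fun w => (rind s i w)%:R) (pi \o always_part) /\
    is_cond_exp P (obs_always i) (fun w => (rind s i w)%:R) pi.

Definition weights_ok :=
  (exists K : R, forall i w, `|wOmega s i w| <= K /\ `|wW s i w| <= K) /\
  (forall i, is_cond_exp P (obsX i) (wOmega s i) (cst 1) /\
             is_cond_exp P (obsX i) (wW s i) (cst 1)).

(* The observations being identically distributed, subject 0 serves below as
   the generic one, both in the conditions and in the population quantities. *)

Definition bounded_covariate := exists M : R, forall i w, `|covz s i w| <= M.

(* Division by 0 being 0, the integrand vanishes where f does. *)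
Definition regular_error_density := exists f : R -> R,
  [/\ forall i, is_density P (err s i) f,
      forall t, derivable f t 1,
      exists K : R, forall t, `|f t| <= K /\ `|(f^`()%classic) t| <= K
    & (\int[lebesgue_measure]_t (((f^`()%classic) t / f t) ^+ 2 * f t)%:E
        < +oo)%E].

Definition bounded_censoring_density := exists (g : vec -> R -> R) (K : R),
  is_cond_density P (cens s 0) (covz s 0) g /\ forall z t, g z t <= K.

Definition tail_condition (Theta : set vec) := exists tau xi : R, 0 < xi /\
  forall theta, Theta theta -> exists g : vec -> R,
    is_cond_exp P (covz s 0) (fun w => (at_risk tau theta 0 w)%:R) g /\
    forall z, xi <= g z.

Definition observation_condition :=
  exists (zeta : R) (pi : R * bool * 'rV[R]_d2 -> R),
  [/\ 0 < zeta,
      is_cond_exp P (obs_always 0) (fun w => (rind s 0 w)%:R) pi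
    & forall x, zeta <= pi x].

Definition Psi eta rho theta : vec :=
  \row_j \int[P]_w (rho (resid theta 0 w) theta *
    (covz s 0 w ord0 j - eta (resid theta 0 w) theta ord0 j) *
    (obsD 0 w)%:R).

Definition Psi_n n w eta rho theta : vec :=
  n%:R^-1 *: \sum_(i < n)
    (wOmega s i w * rho (resid theta i w) theta * (obsD i w)%:R) *:
    (covz s i w - eta (resid theta i w) theta).

(* Inversion sends 0 to 0, so these ratios vanish with their denominator. *)
Definition eta0 : R -> vec -> vec := fun t theta =>
  (\int[P]_w (at_risk t theta 0 w)%:R)^-1 *:
  \row_j \int[P]_w ((at_risk t theta 0 w)%:R * covz s 0 w ord0 j).

Definition surv : R -> vec -> R := fun t theta =>
  fine (P [set w | at_risk t theta 0 w]).

Definition eta_hat n w : R -> vec -> vec := fun t theta =>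
  (\sum_(j < n) wW s j w * (at_risk t theta j w)%:R)^-1 *:
  \sum_(j < n) (wW s j w * (at_risk t theta j w)%:R) *: covz s j w.

Definition rho_hat n w : R -> vec -> R := fun t theta =>
  (\sum_(j < n) wW s j w * (at_risk t theta j w)%:R) / \sum_(j < n) wW s j w.

Definition unique_root (Theta : set vec) (rho0 : R -> vec -> R) (theta0 : vec) :=
  [/\ Theta theta0, Psi eta0 rho0 theta0 = 0
    & forall theta, Theta theta -> Psi eta0 rho0 theta = 0 -> theta = theta0].

(* The functions (y, z) |-> g (y - theta'z, theta), theta in Theta, for all
   members g of G, lie in one Glivenko-Cantelli class for the law of (Y, Z). *)
Definition in_GC_class (Theta : set vec) (G : set (R -> vec -> R)) :=
  exists F : set (R * vec -> R),
    glivenko_cantelli P (fun w => (obsY 0 w, covz s 0 w)) F /\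
    forall g theta, G g -> Theta theta ->
      F (fun x => g (x.1 - dotp theta x.2) theta).

Definition coords (G : set (R -> vec -> vec)) : set (R -> vec -> R) :=
  [set g | exists2 eta, G eta & exists j, g = fun t theta => eta t theta ord0 j].

(* eta n w, rho n w are the plug-in functions at sample size n and outcome w *)
Definition plug_in (Theta : set vec) (rho0 : R -> vec -> R)
    (eta : nat -> T -> R -> vec -> vec) (rho : nat -> T -> R -> vec -> R) :=
  [/\ exists delta : nat -> R,
        [/\ nonincreasing_seq delta, delta @ \oo --> (0 : R)
          & forall n w,
            (supnorm Theta (fun t th => (eta n w t th - eta0 t th)%R)
               <= (delta n)%:E)%E /\
            (supnorm Theta (fun t th => (rho n w t th - rho0 t th)%R)
               <= (delta n)%:E)%E],
      [/\ in_GC_class Theta (coords [set e | exists n w, e = eta n w]),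
          in_GC_class Theta (coords [set eta0]),
          in_GC_class Theta [set r | exists n w, r = rho n w]
        & in_GC_class Theta [set rho0]]
    & [/\ forall n w, (supnorm Theta (eta n w) < +oo)%E,
          (supnorm Theta eta0 < +oo)%E,
          forall n w, (supnorm Theta (rho n w) < +oo)%E
        & (supnorm Theta rho0 < +oo)%E]].

Definition approximate_root
    (eta : nat -> T -> R -> vec -> vec) (rho : nat -> T -> R -> vec -> R)
    (theta_hat : nat -> T -> vec) :=
  cvg0_outer P
    (fun n w => (`|Psi_n n w (eta n w) (rho n w) (theta_hat n w)|)%:E).

Definition consistent (theta_hat : nat -> T -> vec) (theta0 : vec) :=
  cvg0_outer P (fun n w => (`|theta_hat n w - theta0|)%:E).

End aft.

(* Main.v *)
From HB Require Import structures.
Require Import Defs.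
From mathcomp Require Import all_boot all_order all_algebra.
From mathcomp Require Import all_classical all_reals all_analysis.
From mathcomp Require Import measurable_realfun.
From mathcomp Require Import ring lra.

Set Implicit Arguments.
Unset Strict Implicit.
Unset Printing Implicit Defensive.

Import Order.TTheory GRing.Theory Num.Theory.
Import numFieldNormedType.Exports.

Local Open Scope classical_set_scope.
Local Open Scope ring_scope.

(** The criterion is handled through one notion, [ulln]: a set of bounded
    measurable functions of the observation obeys a uniform weak law of large
    numbers, the supremum being controlled by measurable covers so that no
    measurability of suprema is ever required.

    The score of subject i at theta is Omega_i Delta_i rho0 (Z_i - eta0).  The
    weight rho0 is only known to range over a Glivenko-Cantelli class, so the
    point is that this property survives multiplication by
    Omega Delta (Z - eta0).

    For one fixed bounded multiplier this is [ulln_gc].  By approximation with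
    step functions the multiplier may be the indicator of an event B.  Take an
    independent copy of the sample on the product space, and exchange the
    arguments of f between X_i and its copy X_i' exactly when both lie in B:
    this preserves the law of the sample, and the hypothesis applies to the
    original and to the exchanged sample, since it is made for every i.i.d.
    sequence with the given law.  Subtracting the two, the averages of
    1_B(X_i) 1_B(X_i') (f(X_i) - f(X_i')) tend to 0 uniformly in f, and
    integrating the copy out leaves P(B) times the average of 1_B f, minus
    E[1_B f] times the average of 1_B, whence the claim by the law of large
    numbers for 1_B.

    The other factor eta0 depends on theta too, but the bounded densities of
    the errors and of the censoring times make S(t, theta) = P(eps_theta >= t)
    and N(t, theta) = E[1(eps_theta >= t) Z] Lipschitz.  Hence eta0 = N / S is
    uniformly continuous where S >= k, the residual falls where S < k with
    probability at most k, and a finite net of the compact set Theta suffices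
    ([ulln_score]).  Replacing eta0 and rho0 by functions within delta_n of
    them changes the criterion by O(delta_n), which gives (i).  Part (ii)
    follows by compactness: a continuous function on Theta with a single zero
    stays away from 0 outside each neighbourhood of that zero.

    In (iii), rho_hat (Z - eta_hat) is (D_n Z - N_n) / W_n unless D_n = 0, where
    D_n, N_n and W_n are the averages of W 1(eps >= t), W 1(eps >= t) Z and W.  These
    converge uniformly to S, N and 1 by approximation over a finite net of
    pairs (t, theta), so that no control of the ratio N / S where S is small
    is needed ([hat_vanishing]); and S Z - N = S (Z - eta0) is continuous in
    theta, which makes the limit criterion continuous. *)

(** * Convergence to 0 in outer probability *)

Section vanishing.
Context d (T : measurableType d) (R : realType) (P : probability T R).
Implicit Types D : nat -> set T.

(** Outer measure tending to 0, phrased with measurable covers: a cover can be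
    cut into sections and integrated, which an outer measure cannot. *)
Definition vanishing D := forall e : R, 0 < e -> exists N, forall n,
  (N <= n)%N -> exists A, [/\ measurable A, (P A <= e%:E)%E & D n `<=` A].

Lemma vanishing_mu_ext D :
  vanishing D -> (fun n => mu_ext P (D n)) @ \oo --> 0%E.
Proof.
move=> vD; apply/fine_cvgP.
have key (e : R) : 0 < e -> \forall n \near \oo, (mu_ext P (D n) <= e%:E)%E.
  move=> e0; have [N HN] := vD _ e0; exists N => // n /= /HN[A [mA PA DA]].
  by rewrite (le_trans (le_mu_ext P DA))// measurable_mu_extE.
have fin (e : R) : 0 < e -> \forall n \near \oo, (mu_ext P (D n)) \is a fin_num.
  move=> e0; move: (key e e0); apply: filterS => n le.
  by rewrite ge0_fin_numE ?mu_ext_ge0// (le_lt_trans le)// ltry.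
split; first exact: (fin 1).
apply/cvgrPdist_le => e e0; near=> n; rewrite sub0r normrN ger0_norm; last first.
  by rewrite fine_ge0// mu_ext_ge0.
rewrite -lee_fin fineK; first by near: n; exact: key.
by near: n; exact: (fin 1).
Unshelve. all: by end_near. Qed.

Lemma mu_ext_vanishing D :
  (fun n => mu_ext P (D n)) @ \oo --> 0%E -> vanishing D.
Proof.
move=> cD e e0.
have : \forall n \near \oo, (mu_ext P (D n) < e%:E)%E.
  have e1 : (0%E < e%:E)%E by rewrite lte_fin.
  exact: (cD [set y | (y < e%:E)%E] (open_ereal_lt' e1)).
case=> N _ HN; exists N => n /HN /=.
case/ereal_inf_lt => x [B [mB DB] <-] Be.
exists (\bigcup_k B k); split; [exact: bigcup_measurable| |exact: DB].
apply: le_trans (ltW Be); apply: measure_sigma_subadditive => //.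
exact: bigcup_measurable.
Qed.

Lemma cvg0_outerP (D : nat -> T -> \bar R) : cvg0_outer P D <->
  forall e : R, 0 < e -> vanishing (fun n => [set w | (e%:E < D n w)%E]).
Proof.
by split=> H e e0; [exact: mu_ext_vanishing (H e e0)
                   |exact: vanishing_mu_ext (H e e0)].
Qed.

Lemma vanishing_sub D' D : vanishing D' ->
  (exists N, forall n, (N <= n)%N -> D n `<=` D' n) -> vanishing D.
Proof.
move=> vD [N1 DD] e e0; have [N2 HN] := vD e e0.
exists (maxn N1 N2) => n; rewrite geq_max => /andP[n1 n2].
have [A [mA PA DA]] := HN _ n2; exists A; split => //.
exact: subset_trans (DD _ n1) DA.
Qed.

Lemma vanishing0 : vanishing (fun=> set0).
Proof.
move=> e e0; exists 0%N => n _; exists set0; split => //.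
by rewrite measure0 lee_fin ltW.
Qed.

Lemma vanishingU D D' : vanishing D -> vanishing D' ->
  vanishing (fun n => D n `|` D' n).
Proof.
move=> vD vD' e e0; have e2 : 0 < e / 2 by rewrite divr_gt0.
have [N HN] := vD _ e2; have [N' HN'] := vD' _ e2.
exists (maxn N N') => n; rewrite geq_max => /andP[/HN[A [mA PA DA]]].
move=> /HN'[A' [mA' PA' DA']].
exists (A `|` A'); split; [exact: measurableU| |exact: setUSS].
rewrite (le_trans (measureU2 P mA mA'))//.
by rewrite [e]splitr EFinD leeD.
Qed.

Lemma vanishing_bigU (I : eqType) (s : seq I) (D : I -> nat -> set T) :
  (forall i, vanishing (D i)) ->
  vanishing (fun n => [set w | exists2 i, i \in s & D i n w]).
Proof.
move=> vD; elim: s => [|a s IH].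
  by apply: vanishing_sub vanishing0 _; exists 0%N => n _ w [].
apply: vanishing_sub (vanishingU (vD a) IH) _; exists 0%N => n _ w [i].
by rewrite inE => /predU1P[->|si] Dw; [left|right; exists i].
Qed.

End vanishing.

(** * Bounded measurable functions and their expectations *)

Section bounded_functions.
Context d (T : measurableType d) (R : realType).
Implicit Types f g : T -> R.

(** Every function met below is bounded, so this one predicate discharges all
    integrability conditions of the linearity and monotonicity rules. *)
Definition bounded_mfun f :=
  measurable_fun setT f /\ exists K, forall x, `|f x| <= K.

Lemma bounded_mfunP f : bounded_mfun f ->
  measurable_fun setT f /\ exists2 K, 0 < K & forall x, `|f x| <= K.
Proof.
move=> [mf [K fK]]; split => //; exists (`|K| + 1).
  by rewrite ltr_wpDl.
by move=> x; rewrite (le_trans (fK x))// (le_trans (ler_norm _))// lerDl.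
Qed.

Lemma bounded_mfun_cst c : bounded_mfun (cst c).
Proof. by split => //; exists `|c|. Qed.

Lemma bounded_mfunD f g : bounded_mfun f -> bounded_mfun g ->
  bounded_mfun (fun x => f x + g x).
Proof.
move=> [mf [K fK]] [mg [L gL]]; split; first exact: measurable_funD.
by exists (K + L) => x; rewrite (le_trans (ler_normD _ _))// lerD.
Qed.

Lemma bounded_mfunM f g : bounded_mfun f -> bounded_mfun g ->
  bounded_mfun (fun x => f x * g x).
Proof.
move=> [mf [K fK]] [mg [L gL]]; split; first exact: measurable_funM.
by exists (K * L) => x; rewrite normrM ler_pM.
Qed.

Lemma bounded_mfunZ c f : bounded_mfun f -> bounded_mfun (fun x => c * f x).
Proof. by move=> bf; apply: bounded_mfunM bf; exact: bounded_mfun_cst. Qed.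

Lemma bounded_mfunN f : bounded_mfun f -> bounded_mfun (fun x => - f x).
Proof.
move=> bf; rewrite (_ : (fun x => - f x) = (fun x => -1 * f x)).
  exact: bounded_mfunZ.
by apply/funext => x; rewrite mulN1r.
Qed.

Lemma bounded_mfunB f g : bounded_mfun f -> bounded_mfun g ->
  bounded_mfun (fun x => f x - g x).
Proof. by move=> bf /bounded_mfunN; exact: bounded_mfunD. Qed.

Lemma bounded_mfun_norm f : bounded_mfun f -> bounded_mfun (fun x => `|f x|).
Proof.
move=> [mf [K fK]]; split; first exact: measurableT_comp.
by exists K => x; rewrite normr_id.
Qed.

Lemma bounded_mfun_sum (I : Type) (s : seq I) (f : I -> T -> R) :
  (forall i, bounded_mfun (f i)) -> bounded_mfun (fun x => \sum_(i <- s) f i x).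
Proof.
move=> bf; elim: s => [|a s IH].
  under [X in bounded_mfun X]funext do rewrite big_nil.
  exact: bounded_mfun_cst.
under [X in bounded_mfun X]funext do rewrite big_cons.
exact: bounded_mfunD.
Qed.

Lemma bounded_mfun_indic A : measurable A -> bounded_mfun (\1_A : T -> R).
Proof.
move=> mA; split; first exact: measurable_indic.
by exists 1 => x; rewrite indicE; case: (_ \in _); rewrite ?normr0 ?normr1.
Qed.

Lemma measurable_set_bool (b : T -> bool) :
  measurable_fun setT b -> measurable [set x | b x].
Proof.
move=> mb; rewrite -[X in measurable X]setTI.
exact: (mb measurableT [set true]).
Qed.

Lemma bounded_mfun_bool (b : T -> bool) :
  measurable_fun setT b -> bounded_mfun (fun x => (b x)%:R).
Proof.
move=> mb; rewrite (_ : (fun _ => _) = \1_[set x | b x]).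
  by apply: bounded_mfun_indic; exact: measurable_set_bool.
apply/funext => x; rewrite indicE; have [bx|bx] := boolP (b x).
  by rewrite mem_set.
by rewrite memNset//=; exact/negP.
Qed.

End bounded_functions.

Lemma bounded_mfun_comp d (T : measurableType d) d' (S : measurableType d')
    (R : realType) (f : S -> R) (X : T -> S) :
  measurable_fun setT X -> bounded_mfun f -> bounded_mfun (fun x => f (X x)).
Proof.
move=> mX [mf [K fK]]; split; first exact: measurableT_comp.
by exists K => x.
Qed.

Section expectation.
Context d (T : measurableType d) (R : realType) (P : probability T R).
Implicit Types f g : T -> R.

Lemma bounded_mfun_integrable f : bounded_mfun f ->
  P.-integrable setT (EFin \o f).
Proof.
move=> [mf [K fK]]; apply: measurable_bounded_integrable => //.
  by rewrite -ge0_fin_numE// fin_num_measure.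
by exists K; split => [|M KM x _ /=]; [exact: num_real|rewrite (le_trans (fK x))// ltW].
Qed.
Hint Resolve bounded_mfun_integrable : core.

Lemma expectD f g : bounded_mfun f -> bounded_mfun g ->
  \int[P]_x (f x + g x) = \int[P]_x f x + \int[P]_x g x.
Proof. by move=> *; rewrite RintegralD//; exact: bounded_mfun_integrable. Qed.

Lemma expectB f g : bounded_mfun f -> bounded_mfun g ->
  \int[P]_x (f x - g x) = \int[P]_x f x - \int[P]_x g x.
Proof. by move=> *; rewrite RintegralB//; exact: bounded_mfun_integrable. Qed.

Lemma expectZ c f : bounded_mfun f -> \int[P]_x (c * f x) = c * \int[P]_x f x.
Proof. by move=> *; rewrite RintegralZl//; exact: bounded_mfun_integrable. Qed.

Lemma expect_cst (c : R) : \int[P]_x c = c.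
Proof.
rewrite Rintegral_cst// -[RHS]mulr1; congr (_ * _).
exact: (congr1 fine (probability_setT P)). Qed.

Lemma expect_sum (I : Type) (s : seq I) (f : I -> T -> R) :
  (forall i, bounded_mfun (f i)) ->
  \int[P]_x (\sum_(i <- s) f i x) = \sum_(i <- s) \int[P]_x f i x.
Proof.
move=> bf; elim: s => [|a s IH].
  by rewrite big_nil; under eq_Rintegral do rewrite big_nil; rewrite expect_cst.
under eq_Rintegral do rewrite big_cons.
by rewrite big_cons -IH expectD//; exact: bounded_mfun_sum.
Qed.

Lemma expect_indic A : measurable A -> \int[P]_x \1_A x = fine (P A).
Proof. by move=> mA; rewrite /Rintegral integral_indic// setIT. Qed.

Lemma expect_bool (b : T -> bool) : measurable_fun setT b ->
  \int[P]_w (b w)%:R = fine (P [set w | b w]).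
Proof.
move=> mb; rewrite -expect_indic; last exact: measurable_set_bool.
apply: eq_Rintegral => w _; rewrite indicE; have [h|h] := boolP (b w).
  by rewrite mem_set.
by rewrite memNset//; exact/negP.
Qed.

Lemma le_expect f g : bounded_mfun f -> bounded_mfun g ->
  (forall x, f x <= g x) -> \int[P]_x f x <= \int[P]_x g x.
Proof. by move=> *; apply: le_Rintegral => //; exact: bounded_mfun_integrable. Qed.

Lemma le_norm_expect f g : bounded_mfun f -> bounded_mfun g ->
  (forall x, `|f x| <= g x) -> `|\int[P]_x f x| <= \int[P]_x g x.
Proof.
move=> bf bg fg.
rewrite (le_trans (le_normr_Rintegral _ _))//; first exact: bounded_mfun_integrable.
by apply: le_expect => //; exact: bounded_mfun_norm.
Qed.

Lemma norm_expect_le f K : bounded_mfun f -> (forall x, `|f x| <= K) ->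
  `|\int[P]_x f x| <= K.
Proof.
move=> bf fK; rewrite -[leRHS]expect_cst; apply: le_norm_expect => //.
exact: bounded_mfun_cst.
Qed.

Lemma fine_probE A : measurable A -> (fine (P A))%:E = P A.
Proof. by move=> mA; rewrite fineK// fin_num_measure. Qed.

Lemma markov_bounded f e : bounded_mfun f -> (forall x, 0 <= f x) -> 0 < e ->
  (P [set x | (e <= f x)%R] <= (\int[P]_x f x / e)%:E)%E.
Proof.
move=> bf f0 e0.
have mA : measurable [set x | (e <= f x)%R].
  rewrite (_ : mkset _ = f @^-1` `[e, +oo[).
    rewrite -[X in measurable X]setTI; apply: bf.1 => //.
  by apply/seteqP; split=> x /=; rewrite in_itv/= andbT.
rewrite -fine_probE// lee_fin -expect_indic// ler_pdivlMr// mulrC -expectZ; last first.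
  exact: bounded_mfun_indic.
apply: le_expect => //.
  by apply: bounded_mfunZ; exact: bounded_mfun_indic.
move=> x; rewrite indicE; have [|] := boolP (x \in _).
  by rewrite in_setE /= mulr1.
by rewrite mulr0.
Qed.

End expectation.

(** * Uniform weak laws of large numbers *)

Lemma norm_average_le (R : realType) n (a : nat -> R) (b : R) : 0 <= b ->
  (forall i, `|a i| <= b) -> `|n%:R^-1 * \sum_(i < n) a i| <= b.
Proof.
move=> b0 ab; case: n => [|n]; first by rewrite big_ord0 mulr0 normr0.
rewrite normrM ger0_norm ?invr_ge0// mulrC ler_pdivrMr ?ltr0n//.
rewrite (le_trans (ler_norm_sum _ _ _))// mulr_natr -[X in _ <= _ *+ X]card_ord.
by rewrite -sumr_const; apply: ler_sum.
Qed.

Section uniform_lln.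
Context d (T : measurableType d) (R : realType) (P : probability T R).
Context dS (S : measurableType dS) (X : nat -> T -> S).
Implicit Types (h b m : S -> R) (H : set (S -> R)).

Definition smean h n w : R := n%:R^-1 * \sum_(i < n) h (X i w).

Definition pmean h : R := \int[P]_w h (X 0%N w).

(** Boundedness is part of the notion so that the closure rules below chain
    without side conditions; no bound uniform over H is asked for. *)
Definition ulln H := (forall h, H h -> bounded_mfun h) /\
  forall e : R, 0 < e -> vanishing P
    (fun n => [set w | exists2 h, H h & e < `|smean h n w - pmean h|]).

Lemma smeanD h b n w : smean (fun x => h x + b x) n w = smean h n w + smean b n w.
Proof. by rewrite /smean big_split mulrDr. Qed.

Lemma smeanZ c h n w : smean (fun x => c * h x) n w = c * smean h n w.
Proof. by rewrite /smean -mulr_sumr mulrCA. Qed.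

Lemma smeanB h b n w : smean (fun x => h x - b x) n w = smean h n w - smean b n w.
Proof. by rewrite /smean sumrB mulrBr. Qed.

Lemma smean_cst c n w : (0 < n)%N -> smean (cst c) n w = c.
Proof.
move=> n0; rewrite /smean sumr_const card_ord -[c *+ n]mulr_natl mulKf//.
by rewrite pnatr_eq0 -lt0n.
Qed.

Lemma le_smean h b n w : (forall i, h (X i w) <= b (X i w)) ->
  smean h n w <= smean b n w.
Proof. by move=> hb; rewrite ler_wpM2l ?invr_ge0// ler_sum. Qed.

Lemma norm_smean h n w : `|smean h n w| <= smean (fun x => `|h x|) n w.
Proof.
by rewrite /smean normrM ger0_norm ?invr_ge0// ler_wpM2l ?invr_ge0// ler_norm_sum.
Qed.

Lemma le_norm_smean h b n w :
  (forall i, `|h (X i w)| <= b (X i w)) -> `|smean h n w| <= smean b n w.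
Proof. by move=> hb; rewrite (le_trans (norm_smean _ _ _))// le_smean. Qed.

Hypothesis mX : forall i, measurable_fun setT (X i).

Lemma bounded_mfunX h i : bounded_mfun h -> bounded_mfun (fun w => h (X i w)).
Proof. exact: bounded_mfun_comp. Qed.

Lemma pmeanD h b : bounded_mfun h -> bounded_mfun b ->
  pmean (fun x => h x + b x) = pmean h + pmean b.
Proof. by move=> bh bb; rewrite /pmean expectD//; exact: bounded_mfunX. Qed.

Lemma pmeanB h b : bounded_mfun h -> bounded_mfun b ->
  pmean (fun x => h x - b x) = pmean h - pmean b.
Proof. by move=> bh bb; rewrite /pmean expectB//; exact: bounded_mfunX. Qed.

Lemma pmeanZ c h : bounded_mfun h -> pmean (fun x => c * h x) = c * pmean h.
Proof. by move=> bh; rewrite /pmean expectZ//; exact: bounded_mfunX. Qed.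

Lemma pmean_cst c : pmean (cst c) = c.
Proof. exact: expect_cst. Qed.

Lemma le_norm_pmean h b : bounded_mfun h -> bounded_mfun b ->
  (forall w, `|h (X 0%N w)| <= b (X 0%N w)) -> `|pmean h| <= pmean b.
Proof. by move=> bh bb hb; apply: le_norm_expect => //; exact: bounded_mfunX. Qed.

Lemma norm_pmean_le h K : bounded_mfun h -> (forall w, `|h (X 0%N w)| <= K) ->
  `|pmean h| <= K.
Proof. by move=> bh hK; apply: norm_expect_le => //; exact: bounded_mfunX. Qed.

Lemma ulln_sub H H' : ulln H' -> H `<=` H' -> ulln H.
Proof.
move=> [bH vH] HH; split=> [h /HH/bH//|e e0].
apply: vanishing_sub (vH e e0) _; exists 0%N => n _ w [h Hh hw].
by exists h => //; exact: HH.
Qed.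

Lemma ullnD H H' : ulln H -> ulln H' ->
  ulln [set f | exists h b, [/\ H h, H' b & f = fun x => h x + b x]].
Proof.
move=> [bH vH] [bH' vH']; split.
  by move=> _ [h [b [/bH bh /bH' bb ->]]]; exact: bounded_mfunD.
move=> e e0; have e2 : 0 < e / 2 by rewrite divr_gt0.
apply: vanishing_sub (vanishingU (vH _ e2) (vH' _ e2)) _.
exists 0%N => n _ w [_ [h [b [Hh Hb ->]]]].
rewrite smeanD pmeanD; [|exact: bH|exact: bH'].
have [h2 lt|h2] := leP (`|smean h n w - pmean h|) (e / 2); last by left; exists h.
right; exists b => //; rewrite ltNge; apply/negP => b2.
move: lt; rewrite ltNge => /negP; apply.
by rewrite opprD addrACA (le_trans (ler_normD _ _))// [leRHS]splitr lerD.
Qed.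

Lemma ullnZ c H : ulln H -> ulln [set f | exists2 h, H h & f = fun x => c * h x].
Proof.
move=> [bH vH]; split; first by move=> _ [h /bH bh ->]; exact: bounded_mfunZ.
move=> e e0; have c0 : 0 < `|c| + 1 by rewrite ltr_wpDl.
have ec : 0 < e / (`|c| + 1) by rewrite divr_gt0.
apply: vanishing_sub (vH _ ec) _.
exists 0%N => n _ w [_ [h Hh ->]]; rewrite smeanZ pmeanZ; last exact: bH.
rewrite -mulrBr normrM => le; exists h => //.
rewrite ltr_pdivrMr// (lt_le_trans le)// mulrC ler_wpM2l//.
by rewrite lerDl.
Qed.

Lemma ulln_bigU (I : eqType) (s : seq I) (H : I -> set (S -> R)) :
  (forall i, ulln (H i)) -> ulln [set h | exists2 i, i \in s & H i h].
Proof.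
move=> uH; split=> [h [i _]|e e0]; first exact: (uH i).1.
apply: vanishing_sub (vanishing_bigU s (fun i => (uH i).2 e e0)) _.
by exists 0%N => n _ w [h [i si Hh] hw]; exists i => //; exists h.
Qed.

(** A one-sided bracketing argument.  If each h lies within b of some h' and the
    averages of h' and of b are both uniformly close to their means, then the
    average of h is within mean b <= e of that of h', up to the two errors.
    Taking b to be a small constant plus multiples of indicators of unlikely
    events covers both uniform approximation and approximation outside such
    events; the estimate is needed only at sample points, where bounds on the
    covariates are available. *)
Lemma ulln_approx H : (forall h, H h -> bounded_mfun h) ->
  (forall e, 0 < e -> exists H' B, [/\ ulln H', ulln B,
     forall b, B b -> pmean b <= e &
     forall h, H h -> exists h' b, [/\ H' h', B b &
       forall i w, `|h (X i w) - h' (X i w)| <= b (X i w)]]) ->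
  ulln H.
Proof.
move=> bH app; split => // e e0; have e4 : 0 < e / 4 by rewrite divr_gt0.
have [H' [B [[bH' vH'] [bB vB] Be hh']]] := app _ e4.
apply: vanishing_sub (vanishingU (vH' _ e4) (vB _ e4)) _.
exists 0%N => n _ w [h Hh lt].
have [h' [b [Hh' Hb hb]]] := hh' _ Hh.
have [bh bh' bb] := And3 (bH _ Hh) (bH' _ Hh') (bB _ Hb).
have [h4|h4] := leP (`|smean h' n w - pmean h'|) (e / 4); last by left; exists h'.
right; exists b => //; rewrite ltNge; apply/negP => b4.
have i1 : `|smean h n w - smean h' n w| <= smean b n w.
  by rewrite -smeanB; exact: le_norm_smean.
have i2 : `|pmean h - pmean h'| <= pmean b.
  by rewrite -pmeanB//; apply: le_norm_pmean => //; exact: bounded_mfunB.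
have := Be _ Hb.
move: lt i1 i2 h4 b4; rewrite !ler_norml ltNge => /negP lt /andP[? ?] /andP[? ?].
by move=> /andP[? ?] /andP[? ?] ?; apply: lt; rewrite ler_norml; lra.
Qed.

End uniform_lln.

(** * Independent copies of an i.i.d. sequence *)

(** Rectangles form a generating class stable by intersection, so a finite
    measure on a product is determined by its values on them. *)
Lemma measure_eq_rect d1 d2 (S1 : measurableType d1) (S2 : measurableType d2)
    (R : realType) (mu nu : {measure set (S1 * S2) -> \bar R}) :
  (mu setT < +oo)%E ->
  (forall A B, measurable A -> measurable B -> mu (A `*` B) = nu (A `*` B)) ->
  forall C, measurable C -> mu C = nu C.
Proof.
move=> fmu rect C mC.
apply: (measure_unique [set A `*` B | A in measurable & B in measurable]
          (fun=> setT)) => //.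
- exact: measurable_prod_measurableType.
- move=> _ _ [A mA [B mB <-]] [A' mA' [B' mB' <-]]; rewrite -setXI.
  by exists (A `&` A'); [exact: measurableI|exists (B `&` B') => //; exact: measurableI].
- by move=> _; exists setT => //; exists setT => //; rewrite setXTT.
- by rewrite bigcup_const.
- by move=> _ [A mA [B mB <-]]; exact: rect.
Qed.

Lemma same_law_expect d (T : measurableType d) d' (T' : measurableType d')
    (R : realType) (P : probability T R) (P' : probability T' R)
    dS (S : measurableType dS) (X : T -> S) (X' : T' -> S) (h : S -> R) :
  measurable_fun setT X -> measurable_fun setT X' -> same_law P P' X' X ->
  bounded_mfun h -> \int[P']_w h (X' w) = \int[P]_w h (X w).
Proof.
move=> mX mX' law bh; congr fine.
have mh : measurable_fun setT (EFin \o h) by apply/measurable_EFinP; exact: bh.1.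
have := @integral_pushforward _ _ _ _ R X mX P setT (EFin \o h) mh.
rewrite preimage_setT => <- //; last first.
  exact/bounded_mfun_integrable/bounded_mfun_comp.
have := @integral_pushforward _ _ _ _ R X' mX' P' setT (EFin \o h) mh.
rewrite preimage_setT => <- //; last first.
  exact/bounded_mfun_integrable/bounded_mfun_comp.
by apply: eq_measure_integral => A mA _; exact: law.
Qed.

Section iid_sequences.
Context d (T : measurableType d) (R : realType) (P : probability T R).
Context dS (S : measurableType dS) (X : nat -> T -> S).
Hypothesis iX : iid P X.

Lemma iid_expect (h : S -> R) i :
  bounded_mfun h -> \int[P]_w h (X i w) = pmean P X h.
Proof. by have [mX _ lX] := iX => bh; apply: same_law_expect. Qed.

Lemma iid_comp dV (V : measurableType dV) (phi : S -> V) :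
  measurable_fun setT phi -> iid P (fun i w => phi (X i w)).
Proof.
have [mX indX lX] := iX => mphi; split => [i|n A mA|i A mA].
- exact: measurableT_comp.
- apply: (indX n (fun i => phi @^-1` A i)) => i.
  by rewrite -[X in measurable X]setTI; exact: mphi.
- apply: (lX i (phi @^-1` A)).
  by rewrite -[X in measurable X]setTI; exact: mphi.
Qed.

Lemma measurable_preimageX i A : measurable A -> measurable (X i @^-1` A).
Proof.
by have [mX _ _] := iX => mA; rewrite -[X in measurable X]setTI; exact: mX.
Qed.

Let Z i (w : T * T) := (X i w.1, X i w.2).
Let PP : probability (T * T)%type R := (P \x P)%E.

Let mZ i : measurable_fun setT (Z i).
Proof.
have [mX _ _] := iX; apply: measurable_fun_pair.
  by apply: (measurableT_comp (mX i)); exact: measurable_fst.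
by apply: (measurableT_comp (mX i)); exact: measurable_snd.
Qed.

Let mZC i C : measurable C -> measurable (Z i @^-1` C).
Proof. by move=> mC; rewrite -[X in measurable X]setTI; exact: mZ. Qed.

Let PPrect A B : measurable A -> measurable B -> PP (A `*` B) = (P A * P B)%E.
Proof. exact: product_measure1E. Qed.

Let Zrect i A B : Z i @^-1` (A `*` B) = (X i @^-1` A) `*` (X i @^-1` B).
Proof. by []. Qed.

(* The events C i with i < k are arbitrary and the later ones are rectangles.
   For k = 0 the intersection is itself a rectangle of intersections; raising k
   by 1 frees one coordinate, both sides being finite measures in C k that
   agree on rectangles. *)
Let indZ n : forall k (C : nat -> set (S * S)),
  (forall i, measurable (C i)) ->
  (forall i, (k <= i < n)%N -> exists A B, [/\ measurable A, measurable B & C i = A `*` B]) ->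
  PP (\bigcap_(i < n) (Z i @^-1` C i)) = (\prod_(i < n) PP (Z i @^-1` C i))%E.
Proof.
have [mX indX lX] := iX.
elim=> [C mC rC|k IH C mC rC].
  have /choice[AB rAB] : forall i, exists AB : set S * set S,
      [/\ measurable AB.1, measurable AB.2 & (i < n)%N -> C i = AB.1 `*` AB.2].
    move=> i; have [ni|_] := ltnP i n; last by exists (setT, setT); split => /=.
    by have [A [B [? ? ?]]] := rC i ni; exists (A, B).
  have -> : \bigcap_(i < n) (Z i @^-1` C i) =
      (\bigcap_(i < n) (X i @^-1` (AB i).1)) `*` (\bigcap_(i < n) (X i @^-1` (AB i).2)).
    apply/seteqP; split=> [[w w'] /= H|[w w'] /= [H1 H2] i ni].
      by split=> i ni /=; have := H i ni; have [_ _ ->//] := rAB i => -[].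
    by have [_ _ ->//] := rAB i; split => /=; [exact: H1|exact: H2].
  have m1 i : measurable (AB i).1 by have [] := rAB i.
  have m2 i : measurable (AB i).2 by have [] := rAB i.
  have mcap (D : nat -> set S) : (forall i, measurable (D i)) ->
      measurable (\bigcap_(i < n) (X i @^-1` D i)).
    by move=> mD; apply: bigcap_measurableType => i _; exact: measurable_preimageX.
  rewrite PPrect; [|exact: mcap|exact: mcap].
  rewrite !indX// -big_split/=; apply: eq_bigr => i _.
  have [_ _ ->//] := rAB i; rewrite Zrect PPrect//; exact: measurable_preimageX.
pose C' D i := if i == k then D else C i.
have C'k D i : i != k -> C' D i = C i by rewrite /C' => /negbTE ->.
have IHC A B : measurable A -> measurable B ->
    PP (\bigcap_(i < n) (Z i @^-1` C' (A `*` B) i)) =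
    (\prod_(i < n) PP (Z i @^-1` C' (A `*` B) i))%E.
  move=> mA mB; apply: IH => i; rewrite /C'; case: eqP => [_|/eqP ik] //.
  - exact: measurableX.
  - by move=> _; exists A, B.
  - move=> /andP[ki ni]; apply: rC; rewrite ni andbT ltn_neqAle ki andbT.
    by rewrite eq_sym.
have [kn|nk] := ltnP k n; last first.
  by apply: IH => // i /andP[ki /(leq_ltn_trans ki)]; rewrite ltnNge nk.
pose E := \bigcap_(i in [set i | (i < n)%N && (i != k)]) (Z i @^-1` C i).
have mE : measurable E by apply: bigcap_measurableType => i _; exact: mZC.
have splitE D : \bigcap_(i < n) (Z i @^-1` C' D i) = Z k @^-1` D `&` E.
  apply/seteqP; split=> [w H|w [wD wE] i ni] /=.
    split=> [|i /andP[ni ik]]; first by have := H k kn; rewrite /= /C' eqxx.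
    by have := H i ni; rewrite C'k.
  by have [->|ik] := eqVneq i k; rewrite ?/C' ?eqxx// ifN//; apply: wE; rewrite /= ni.
pose c := (\prod_(i < n | i != Ordinal kn) PP (Z i @^-1` C i))%E.
have prodE D : (\prod_(i < n) PP (Z i @^-1` C' D i) = PP (Z k @^-1` D) * c)%E.
  rewrite (bigD1 (Ordinal kn))//= {1}/C' eqxx; congr (_ * _)%E.
  by apply: eq_bigr => i ik; rewrite C'k.
have cE : c = PP E.
  have := IHC setT setT measurableT measurableT.
  have PPT : PP (Z k @^-1` setT) = 1%E.
    by rewrite preimage_setT; exact: (probability_setT PP).
  by rewrite splitE prodE setXTT PPT mul1e preimage_setT setTI => ->.
pose r : {nonneg R} := NngNum (fine_ge0 (measure_ge0 PP _ : (0 <= PP E)%E)).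
pose restr : {measure set (S * S) -> \bar R} :=
  pushforward (mrestr PP mE) (Z k).
pose mu := restr (mZ k).
pose push : {measure set (S * S) -> \bar R} :=
  pushforward PP (Z k).
pose nu : {measure set (S * S) -> \bar R} := mscale r (push (mZ k)).
have nuE D : nu D = (PP (Z k @^-1` D) * c)%E.
  rewrite cE muleC -[X in (X * _)%E]fineK//; exact: fin_num_measure.
have muE D : mu D = PP (\bigcap_(i < n) (Z i @^-1` C' D i)) by rewrite splitE.
have : mu (C k) = nu (C k).
  apply: measure_eq_rect => // [|A B mA mB]; last by rewrite muE nuE -prodE IHC.
  rewrite muE -ge0_fin_numE//; apply: fin_num_measure.
  apply: bigcap_measurableType => i _; apply: mZC.
  by rewrite /C'; case: ifP.
rewrite muE nuE -prodE.
have C'C : C' (C k) = C by apply/funext => i; rewrite /C'; case: eqP => // ->.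
by rewrite C'C.
Qed.

(** A sample paired with an independent copy of itself is i.i.d.; any measurable
    recombination of the two, such as an exchange, then is as well. *)
Lemma iid_prod : iid (P \x P)%E (fun i w => (X i w.1, X i w.2)).
Proof.
have [mX indX lX] := iX.
split=> [i|n A mA|i A mA]; first exact: mZ.
  apply: (indZ (k := n) (n := n) mA) => i /andP[ni /(leq_ltn_trans ni)].
  by rewrite ltnn.
pose law j : {measure set (S * S) -> \bar R} := pushforward PP (Z j).
have : law mZ i A = law mZ 0%N A.
  apply: measure_eq_rect => // [|B C mB mC].
    by rewrite -ge0_fin_numE//; exact: (fin_num_measure PP _ measurableT).
  rewrite /law /= /pushforward !Zrect !PPrect; try exact: measurable_preimageX.
  by rewrite !(lX i).
by [].
Qed.

End iid_sequences.

(** * The weak law for an event *)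

Section lln.
Context d (T : measurableType d) (R : realType) (P : probability T R).
Context dS (S : measurableType dS) (X : nat -> T -> S).
Hypothesis iX : iid P X.

Lemma iid_pair_prob i j (B : set S) : i != j -> measurable B ->
  P (X i @^-1` B `&` X j @^-1` B) = (P (X i @^-1` B) * P (X j @^-1` B))%E.
Proof.
have [mX indX lX] := iX => ij mB.
pose n := (maxn i j).+1.
have ni : (i < n)%N by rewrite ltnS leq_maxl.
have nj : (j < n)%N by rewrite ltnS leq_maxr.
pose A k := if (k == i) || (k == j) then B else setT.
have mA k : measurable (A k) by rewrite /A; case: ifP.
have -> : X i @^-1` B `&` X j @^-1` B = \bigcap_(k < n) (X k @^-1` A k).
  apply/seteqP; split=> [w [wi wj] k _|w H]; rewrite /= /A.
    by case: ifP => // /orP[]/eqP ->.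
  by split; [have := H i ni|have := H j nj]; rewrite /= /A eqxx ?orbT.
rewrite indX// (bigD1 (Ordinal ni))//= (bigD1 (Ordinal nj))/=; last first.
  by apply/eqP => /(congr1 val)/= /eqP; rewrite eq_sym; exact/negP.
rewrite {1 2}/A !eqxx orbT big1 ?mule1// => k /andP[ki kj].
rewrite /A ifF ?preimage_setT; first exact: (probability_setT P).
by rewrite -[i]/(val (Ordinal ni)) -[j]/(val (Ordinal nj)) !val_eqE (negbTE ki)
           (negbTE kj).
Qed.

(** Chebyshev's inequality: the centred indicators are pairwise orthogonal, so
    the mean square of their average is at most 1/n. *)
Lemma ulln_indic (B : set S) : measurable B -> ulln P X [set \1_B].
Proof.
have [mX indX lX] := iX => mB.
have bB : bounded_mfun (\1_B : S -> R) by exact: bounded_mfun_indic.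
split=> [h ->//|e e0]; set p := pmean P X \1_B.
pose a (x : S) := \1_B x - p.
have ba : bounded_mfun a by apply: bounded_mfunB => //; exact: bounded_mfun_cst.
have mXB i : measurable (X i @^-1` B) by exact: (measurable_preimageX iX).
have pE i : fine (P (X i @^-1` B)) = p.
  rewrite /p -(iid_expect iX i bB) -expect_indic//; exact: mXB.
have p01 : 0 <= p <= 1.
  rewrite -(pE 0%N) fine_ge0//= -lee_fin fine_probE.
    by rewrite probability_le1//; exact: mXB.
  exact: mXB.
have a1 x : `|a x| <= 1.
  rewrite /a indicE ler_norml; case: (_ \in _) => /=; lra.
have Eaa i j : \int[P]_w (a (X i w) * a (X j w)) <= (i == j)%:R.
  have bXi k : bounded_mfun (fun w => \1_B (X k w) : R).
    exact: bounded_mfunX.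
  have [ij|ij] := eqVneq i j.
    apply: le_trans (ler_norm _) _; apply: norm_expect_le => [|w].
      by apply: bounded_mfunM; exact: bounded_mfunX.
    by rewrite normrM mulr_ile1.
  have -> : (fun w => a (X i w) * a (X j w)) =
      (fun w => \1_(X i @^-1` B `&` X j @^-1` B) w
                - (p * (\1_B (X i w) + \1_B (X j w)) - p * p)).
    by apply/funext => w; rewrite /a indicI/= !indicE/=; ring.
  have mI : measurable (X i @^-1` B `&` X j @^-1` B).
    by apply: measurableI; exact: mXB.
  have bp2 : bounded_mfun (fun w => p * (\1_B (X i w) + \1_B (X j w)) : R).
    by apply: bounded_mfunZ; exact: bounded_mfunD.
  rewrite expectB; [|exact: bounded_mfun_indic|]; last first.
    by apply: bounded_mfunB => //; exact: bounded_mfun_cst.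
  rewrite expect_indic// iid_pair_prob// fineM ?fin_num_measure//.
  rewrite expectB//; last exact: bounded_mfun_cst.
  rewrite expectZ; last exact: bounded_mfunD.
  rewrite expectD// expect_cst !pE !(iid_expect iX _ bB) -/p.
  by rewrite (_ : _ - _ = 0)//; ring.
pose f n w := (smean X \1_B n w - p) ^+ 2.
have bf n : bounded_mfun (f n).
  have bs : bounded_mfun (fun w => smean X \1_B n w - p : R).
    apply: bounded_mfunB; last exact: bounded_mfun_cst.
    apply: bounded_mfunZ; apply: bounded_mfun_sum => i; exact: bounded_mfunX.
  rewrite (_ : f n = fun w => (smean X \1_B n w - p) * (smean X \1_B n w - p)).
    exact: bounded_mfunM.
  by apply/funext => w; rewrite /f expr2.
have Ef n : (0 < n)%N -> \int[P]_w f n w <= n%:R^-1.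
  move=> n0; have n0' : n%:R != 0 :> R by rewrite pnatr_eq0 -lt0n.
  have -> : f n = fun w => (n%:R^-1 * n%:R^-1) *
      \sum_(i < n) \sum_(j < n) (a (X i w) * a (X j w)).
    apply/funext => w; rewrite /f.
    have -> : smean X \1_B n w - p = smean X a n w.
      by rewrite smeanB; congr (_ - _); rewrite smean_cst.
    rewrite /smean expr2 mulrACA; congr (_ * _).
    by rewrite mulr_suml; apply: eq_bigr => i _; rewrite mulr_sumr.
  have baa i j : bounded_mfun (fun w => a (X i w) * a (X j w)).
    by apply: bounded_mfunM; exact: bounded_mfunX.
  rewrite expectZ; last by do 2 apply: bounded_mfun_sum => ?.
  rewrite expect_sum; last by move=> i; apply: bounded_mfun_sum.
  rewrite [leRHS](_ : _ = n%:R^-1 * n%:R^-1 * \sum_(i < n) (1 : R)); last first.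
    by rewrite sumr_const card_ord mulfVK.
  apply: ler_wpM2l; first by rewrite mulr_ge0// invr_ge0.
  apply: ler_sum => i _; rewrite expect_sum//.
  apply: (@le_trans _ _ (\sum_(j < n) (i == j)%:R)).
    by apply: ler_sum => j _; rewrite (le_trans (Eaa _ _)).
  by rewrite (bigD1 i)//= eqxx big1 ?addr0// => j /negbTE; rewrite eq_sym => ->.
move=> u u0; have e20 : 0 < e ^+ 2 by rewrite exprn_gt0.
(* Chebyshev bounds the probability by 1 / (n e^2), at most u from here on. *)
pose N := (Num.truncn (e ^+ 2 * u)^-1).+1; exists N => n Nn.
have n0 : (0 < n)%N by exact: leq_trans Nn.
exists [set w | e ^+ 2 <= f n w]; split.
- rewrite (_ : mkset _ = f n @^-1` `[e ^+ 2, +oo[).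
    rewrite -[X in measurable X]setTI; apply: (bf n).1 => //.
  by apply/seteqP; split=> x /=; rewrite in_itv/= andbT.
- have f0 w : 0 <= f n w by exact: sqr_ge0.
  rewrite (le_trans (markov_bounded P (bf n) f0 e20))// lee_fin.
  rewrite ler_pdivrMr// (le_trans (Ef n n0))// mulrC.
  rewrite -[leRHS]invrK lef_pV2 ?posrE ?invr_gt0 ?mulr_gt0 ?ltr0n//.
  apply: le_trans (ltW (truncnS_gt _)) _; by rewrite ler_nat.
- move=> w [_ -> we] /=; rewrite /f -[leRHS]real_normK ?num_real//.
  by apply: lerXn2r; rewrite ?nnegrE// ltW.
Qed.

End lln.

(** * Multiplying a Glivenko-Cantelli class by an event *)

Section multiplier.
Context d (T : measurableType d) (R : realType) (P : probability T R).
Context dS (S : measurableType dS) (X : nat -> T -> S).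
Context dV (SV : measurableType dV) (V : S -> SV).
Hypotheses (iX : iid P X) (mV : measurable_fun setT V).
Variables (F : set (SV -> R)) (K : R).
Hypothesis FK : forall f v, F f -> `|f v| <= K.
Hypothesis gcF : glivenko_cantelli P (fun w => V (X 0%N w)) F.

Lemma gc_vanishing d' (T' : measurableType d') (P' : probability T' R)
    (Y : nat -> T' -> SV) (e : R) : 0 < e ->
  iid P' Y -> same_law P P' (Y 0%N) (fun w => V (X 0%N w)) ->
  vanishing P' (fun n => [set w | exists2 f, F f &
    e < `|smean Y f n w - pmean P X (f \o V)|]).
Proof.
move=> e0 iY lY; have /cvg0_outerP/(_ e e0) := gcF.2 _ _ _ _ iY lY.
move=> /vanishing_sub; apply; exists 0%N => n _ w [f Ff lt] /=.
apply: (@lt_le_trans _ _ (`|smean Y f n w - pmean P X (f \o V)|)%:E).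
  by rewrite lte_fin.
by apply: ereal_sup_ubound; exists f.
Qed.

Lemma gc_bounded_mfun f : F f -> bounded_mfun (fun x => f (V x)).
Proof.
move=> Ff; split; last by exists K => x; exact: FK.
by apply: (measurableT_comp (gcF.1 _ Ff).1).
Qed.

Variable B : set S.
Hypothesis mB : measurable B.

Let p := pmean P X \1_B.

(** The first coordinate after exchanging the two whenever both lie in B. *)
Definition swap_in (z : S * S) : SV :=
  if (z.1 \in B) && (z.2 \in B) then V z.2 else V z.1.

Let mem_measurable : measurable_fun setT (fun x => x \in B).
Proof.
apply: (measurable_fun_bool true); rewrite setTI.
by rewrite (_ : _ @^-1` _ = B)//; apply/seteqP; split=> x /=; [move/set_mem|move/mem_set].
Qed.

Lemma measurable_swap_in : measurable_fun setT swap_in.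
Proof.
apply: measurable_fun_ifT.
- apply: measurable_and; apply: (measurableT_comp mem_measurable).
    exact: measurable_fst.
  exact: measurable_snd.
- by apply: (measurableT_comp mV); exact: measurable_snd.
- by apply: (measurableT_comp mV); exact: measurable_fst.
Qed.

Lemma same_law_fst : same_law P (P \x P)%E
  (fun w : T * T => V (X 0%N w.1)) (fun w => V (X 0%N w)).
Proof.
move=> A mA; have mVA : measurable (V @^-1` A).
  by rewrite -[X in measurable X]setTI; exact: mV.
rewrite (_ : _ @^-1` A = (X 0%N @^-1` (V @^-1` A)) `*` setT); last first.
  by apply/seteqP; split=> [[w w']|[w w'] []].
rewrite [LHS]product_measure1E//; last exact: (measurable_preimageX iX).
rewrite -[RHS]mule1; congr (_ * _)%E; exact: (probability_setT P).
Qed.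

(** The exchange acts on U x U only, and there it turns U x (U and W) into
    (U and W) x U, which has the same product measure. *)
Lemma same_law_swap : same_law P (P \x P)%E
  (fun w : T * T => swap_in (X 0%N w.1, X 0%N w.2)) (fun w => V (X 0%N w)).
Proof.
move=> A mA; rewrite -same_law_fst//.
have mVA : measurable (V @^-1` A).
  by rewrite -[X in measurable X]setTI; exact: mV.
pose U := X 0%N @^-1` B; pose W := X 0%N @^-1` (V @^-1` A).
have mU : measurable U by exact: (measurable_preimageX iX).
have mW : measurable W by exact: (measurable_preimageX iX).
pose D := (W `*` setT) `&` ~` (U `*` U).
have mD : measurable D.
  by apply: measurableI; [exact: measurableX|apply: measurableC; exact: measurableX].
have mUW : measurable (U `*` (U `&` W)) by apply: measurableX => //; exact: measurableI.
have mWU : measurable ((U `&` W) `*` U) by apply: measurableX => //; exact: measurableI.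
have -> : (fun w => swap_in (X 0%N w.1, X 0%N w.2)) @^-1` A = U `*` (U `&` W) `|` D.
  apply/seteqP; split=> [[w w']|[w w']] /=; rewrite /swap_in /D /U /W /=.
    case: ifPn => [/andP[]|]; first by rewrite !inE => *; left.
    move=> /negP H ?; right; split => //= -[? ?]; apply: H.
    by rewrite !mem_set.
  case=> /= [[Uw [Uw' Ww']]|[[Ww _] nU]]; first by rewrite !mem_set.
  by rewrite ifN//; apply/negP => /andP[]; rewrite !inE => ? ?; apply: nU.
have -> : (fun w : T * T => V (X 0%N w.1)) @^-1` A = (U `&` W) `*` U `|` D.
  apply/seteqP; split=> [[w w']|[w w']] /=; rewrite /D /U /W /=.
    move=> Aw; have [[Uw Uw']|nU] := pselect (B (X 0%N w) /\ B (X 0%N w')).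
      by left.
    by right.
  by case=> [[[]]|[[]]].
rewrite !measureU//; last 2 first.
- by apply/seteqP; split=> // -[w w'] /= [[[? ?] ?] [_ ]]; exact.
- by apply/seteqP; split=> // -[w w'] /= [[? [? ?]] [_ ]]; exact.
congr (_ + _)%E; rewrite [LHS]product_measure1E//; last exact: measurableI.
by rewrite [RHS]product_measure1E//; [exact: muleC|exact: measurableI].
Qed.

Lemma swap_difference f z : f (V z.1) - f (swap_in z) =
  \1_B z.1 * \1_B z.2 * (f (V z.1) - f (V z.2)) :> R.
Proof.
by rewrite /swap_in !indicE; case: (_ \in _) => /=; case: (_ \in _) => /=; ring.
Qed.

(** The Glivenko-Cantelli property holds for the original and for the exchanged
    sample; their difference retains only the pairs that were exchanged. *)
Lemma swap_vanishing (e : R) : 0 < e -> vanishing (P \x P)%E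
  (fun n => [set w : T * T | exists2 f, F f & e < `|n%:R^-1 * \sum_(i < n)
    (\1_B (X i w.1) * \1_B (X i w.2) * (f (V (X i w.1)) - f (V (X i w.2))))|]).
Proof.
move=> e0; have e2 : 0 < e / 2 by rewrite divr_gt0.
have i1 : iid (P \x P)%E (fun i (w : T * T) => V (X i w.1)).
  have := iid_comp (iid_prod iX) (measurableT_comp mV measurable_fst).
  exact.
have i2 := iid_comp (iid_prod iX) measurable_swap_in.
have v1 := gc_vanishing e2 i1 same_law_fst.
have v2 := gc_vanishing e2 i2 same_law_swap.
apply: vanishing_sub (vanishingU v1 v2) _; exists 0%N => n _ w [f Ff lt].
set q := pmean P X (f \o V).
set a := smean (fun i (w : T * T) => V (X i w.1)) f n w.
set b := smean (fun i (w : T * T) => swap_in (X i w.1, X i w.2)) f n w.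
have abE : a - b = n%:R^-1 * \sum_(i < n) (\1_B (X i w.1) * \1_B (X i w.2) *
    (f (V (X i w.1)) - f (V (X i w.2)))).
  rewrite /a /b /smean -mulrBr -sumrB; congr (_ * _); apply: eq_bigr => i _.
  exact: (swap_difference f (X i w.1, X i w.2)).
rewrite -abE in lt.
have [ha|ha] := leP `|a - q| (e / 2); last by left; exists f.
right; exists f => //; rewrite -/b -/q ltNge; apply/negP => hb.
move: lt; rewrite ltNge => /negP; apply.
move: ha hb; rewrite !ler_norml => /andP[? ?] /andP[? ?]; lra.
Qed.

Let mXB i : measurable (X i @^-1` B).
Proof. exact: (measurable_preimageX iX). Qed.

Let bB : bounded_mfun (\1_B : S -> R).
Proof. exact: bounded_mfun_indic. Qed.

(** The copy is integrated out.  Let A cover the bad event of the product space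
    and h w be the measure of its section at w.  The integrand is at most e
    outside the section and at most 2 L on it, so its integral is at most
    e + 2 L h w; and h is small with high probability by Markov's inequality,
    its mean being the measure of A. *)
Lemma section_vanishing (e : R) : 0 < e -> vanishing P
  (fun n => [set w | exists2 f, F f & 2 * e <
    `|p * smean X (fun x => \1_B x * f (V x)) n w
      - pmean P X (fun x => \1_B x * f (V x)) * smean X \1_B n w|]).
Proof.
have [mX indX lX] := iX.
move=> e0; pose L := `|K| + 1; have L0 : 0 < L by rewrite ltr_wpDl.
have KL : K <= L by rewrite (le_trans (ler_norm _))// lerDl.
(* Markov's inequality at level e / (2 L) turns this bound on the mean of h
   into the bound u on the probability. *)
move=> u u0; have u1 : 0 < u * (e / (2 * L)).
  by rewrite mulr_gt0// divr_gt0// mulr_gt0.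
have [N HN] := swap_vanishing e0 u1; exists N => n /HN[A [mA PA DA]].
pose h w := fine (P (xsection A w)).
have hE w : (h w)%:E = P (xsection A w).
  by rewrite fine_probE//; exact: measurable_xsection.
have mh : bounded_mfun h.
  split; last first.
    exists 1 => w; rewrite ger0_norm ?fine_ge0// -lee_fin hE probability_le1//.
    exact: measurable_xsection.
  apply/measurable_EFinP; rewrite (_ : _ \o _ = P \o xsection A).
    exact: measurable_fun_xsection.
  by apply/funext => w /=; rewrite hE.
have h0 w : 0 <= h w by rewrite fine_ge0.
have Eh : \int[P]_w h w <= u * (e / (2 * L)).
  rewrite -lee_fin (le_trans _ PA)// /Rintegral.
  under eq_integral do rewrite hE.
  by rewrite fineK//; exact: (fin_num_measure (P \x P : probability _ _)%E _ mA).
have eL : 0 < e / (2 * L) by rewrite divr_gt0// mulr_gt0.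
exists [set w | e / (2 * L) <= h w]; split.
- rewrite (_ : mkset _ = h @^-1` `[e / (2 * L), +oo[).
    by rewrite -[X in measurable X]setTI; apply: mh.1.
  by apply/seteqP; split=> x /=; rewrite in_itv/= andbT.
- rewrite (le_trans (markov_bounded P mh h0 eL))// lee_fin.
  by rewrite ler_pdivrMr.
move=> w [f Ff lt] /=; rewrite leNgt; apply/negP => hw.
move: lt; rewrite ltNge => /negP; apply.
have bf : bounded_mfun (fun x => f (V x)) by exact: gc_bounded_mfun.
have bBf : bounded_mfun (fun x => \1_B x * f (V x)) by exact: bounded_mfunM.
pose g w' := n%:R^-1 * \sum_(i < n)
    (\1_B (X i w) * \1_B (X i w') * (f (V (X i w)) - f (V (X i w')))).
have gE w' : g w' = n%:R^-1 * \sum_(i < n) (\1_B (X i w) * f (V (X i w)) * \1_B (X i w')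
    - \1_B (X i w) * (\1_B (X i w') * f (V (X i w')))).
  by congr (_ * _); apply: eq_bigr => i _; ring.
have bt i : bounded_mfun (fun w' => \1_B (X i w) * f (V (X i w)) * \1_B (X i w')
    - \1_B (X i w) * (\1_B (X i w') * f (V (X i w')))).
  apply: bounded_mfunB; apply: bounded_mfunZ; first exact: bounded_mfunX.
  exact: (bounded_mfunX mX i bBf).
have bg : bounded_mfun g.
  by rewrite (funext gE); apply: bounded_mfunZ; exact: bounded_mfun_sum.
have Eg : \int[P]_w' g w' = p * smean X (fun x => \1_B x * f (V x)) n w
      - pmean P X (fun x => \1_B x * f (V x)) * smean X \1_B n w.
  rewrite (funext gE) expectZ; last exact: bounded_mfun_sum.
  rewrite expect_sum// /smean mulrCA [X in _ - X]mulrCA -mulrBr; congr (_ * _).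
  rewrite !mulr_sumr -sumrB; apply: eq_bigr => i _.
  rewrite expectB; last 2 first.
  - by apply: bounded_mfunZ; exact: bounded_mfunX.
  - by apply: bounded_mfunZ; exact: (bounded_mfunX mX i bBf).
  rewrite !expectZ; [|exact: (bounded_mfunX mX i bBf)|exact: bounded_mfunX].
  by rewrite (iid_expect iX i bB) (iid_expect iX i bBf) -/p; ring.
rewrite -Eg.
have bound : bounded_mfun (fun w' => e + 2 * L * \1_(xsection A w) w').
  apply: bounded_mfunD; first exact: bounded_mfun_cst.
  by apply: bounded_mfunZ; apply: bounded_mfun_indic; exact: measurable_xsection.
apply: (@le_trans _ _ (\int[P]_w' (e + 2 * L * \1_(xsection A w) w'))).
  apply: le_norm_expect => // w'; rewrite indicE.
  have [wA|wA] := boolP (w' \in xsection A w); last first.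
    rewrite mulr0 addr0 leNgt; apply/negP => lt; move: wA; rewrite mem_xsection.
    move/negP; apply; rewrite inE; apply: DA; exists f => //.
  rewrite mulr1 (@le_trans _ _ (2 * L))//; last by rewrite lerDr ltW.
  apply: (@norm_average_le R n (fun i => \1_B (X i w) * \1_B (X i w') *
    (f (V (X i w)) - f (V (X i w'))))) => [|i]; first by rewrite mulr_ge0// ltW.
  rewrite !normrM; have := FK (V (X i w)) Ff; have := FK (V (X i w')) Ff => f1 f2.
  have i1 x : `|\1_B x : R| <= 1 by rewrite indicE; case: (_ \in _); rewrite ?normr0 ?normr1.
  rewrite (@le_trans _ _ (1 * `|f (V (X i w)) - f (V (X i w'))|))//.
    by rewrite ler_wpM2r// mulr_ile1.
  by rewrite mul1r (le_trans (ler_normB _ _))//; lra.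
rewrite expectD; [|exact: bounded_mfun_cst|]; last first.
  by apply: bounded_mfunZ; apply: bounded_mfun_indic; exact: measurable_xsection.
rewrite expect_cst expectZ; last by apply: bounded_mfun_indic; exact: measurable_xsection.
rewrite expect_indic; last exact: measurable_xsection.
rewrite -/(h w); move: hw; rewrite ltr_pdivlMr ?mulr_gt0// => hw.
by rewrite [_ * h w]mulrC; lra.
Qed.

(** With p = P(B), the previous lemma compares p times the average of 1_B f with
    E[1_B f] times the average of 1_B, and the latter tends to p: divide by p.
    When p = 0 the averages of 1_B f are dominated by those of 1_B. *)
Lemma ulln_gc_indic :
  ulln P X [set h | exists2 f, F f & h = fun x => \1_B x * f (V x)].
Proof.
have [mX indX lX] := iX.
have bBf f : F f -> bounded_mfun (fun x => \1_B x * f (V x)).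
  by move=> Ff; apply: bounded_mfunM => //; exact: gc_bounded_mfun.
split=> [h [f Ff ->]|e e0]; first exact: bBf.
pose L := `|K| + 1; have L0 : 0 < L by rewrite ltr_wpDl.
have KL : K <= L by rewrite (le_trans (ler_norm _))// lerDl.
have p0 : 0 <= p by apply: Rintegral_ge0 => w _; rewrite indicE.
have BfL f : F f -> forall x, `|\1_B x * f (V x)| <= L * \1_B x.
  move=> Ff x; rewrite normrM mulrC ler_pM// ?(le_trans (FK _ Ff))//.
  by rewrite ger0_norm// indicE.
have qLp f : F f -> `|pmean P X (fun x => \1_B x * f (V x))| <= L * p.
  move=> Ff; rewrite -pmeanZ//; apply: le_norm_pmean => //; first exact: bBf.
    exact: bounded_mfunZ.
  by move=> w; exact: BfL.
have [p1|p1] := eqVneq p 0.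
  have eL : 0 < e / L by rewrite divr_gt0.
  apply: vanishing_sub ((ulln_indic iX mB).2 _ eL) _.
  exists 0%N => n _ w [_ [f Ff ->] lt]; exists \1_B => //.
  rewrite -/p p1 subr0 ltr_pdivrMr//.
  have := qLp f Ff; rewrite p1 mulr0 normr_le0 => /eqP q0.
  rewrite q0 subr0 in lt; rewrite (lt_le_trans lt)//.
  have := le_norm_smean (h := fun x => \1_B x * f (V x)) (b := fun x => L * \1_B x)
    n (fun i => BfL _ Ff (X i w)).
  move=> /le_trans; apply.
  by rewrite smeanZ mulrC ler_wpM2r ?ler_norm// ltW.
have {}p0 : 0 < p by rewrite lt0r p1.
pose e' := p * e / (2 + L).
have e'0 : 0 < e' by rewrite divr_gt0 ?mulr_gt0// addr_gt0.
apply: vanishing_sub (vanishingU (section_vanishing e'0)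
  ((ulln_indic iX mB).2 _ e'0)) _.
exists 0%N => n _ w [_ [f Ff ->] lt].
set M := smean _ _ _ _ in lt; set q := pmean _ _ _ in lt.
have [h1|h1] := leP `|p * M - q * smean X \1_B n w| (2 * e'); last by left; exists f.
right; exists \1_B => //; rewrite -/p ltNge; apply/negP => h2.
move: lt; rewrite ltNge => /negP; apply.
rewrite -(ler_pM2l p0) -[X in X * _](gtr0_norm p0) -normrM.
have -> : p * (M - q) = (p * M - q * smean X \1_B n w) + q * (smean X \1_B n w - p).
  by ring.
rewrite (le_trans (ler_normD _ _))//.
have -> : p * e = 2 * e' + L * e'.
  by rewrite -mulrDl /e' mulrCA divff ?mulr1// gt_eqF// addr_gt0.
rewrite lerD// normrM ler_pM// (le_trans (qLp f Ff))//.
rewrite -[leRHS]mulr1 ler_pM2l//.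
rewrite (le_trans (ler_norm _))//; apply: norm_pmean_le => // x.
by rewrite indicE; case: (_ \in _); rewrite ?normr0 ?normr1.
Qed.

End multiplier.

(** * Bounded multipliers *)

(** Layer-cake staircase: the number of levels k e below u, times e, recovers u
    up to e as long as the N levels reach u. *)
Lemma layer_sum (R : realType) (N : nat) (e u : R) : 0 < e -> 0 <= u ->
  u <= N%:R * e -> `|u - e * \sum_(k < N) (k.+1%:R * e <= u)%R%:R| <= e.
Proof.
move=> e0 u0 uN; pose s n := e * \sum_(k < n) (k.+1%:R * e <= u)%R%:R.
have key n : [/\ s n <= u, s n <= n%:R * e & u <= s n + e \/ s n = n%:R * e].
  elim: n => [|n [su sn alt]]; first by rewrite /s big_ord0 mulr0 mul0r; split; auto.
  have sS : s n.+1 = s n + e * (n.+1%:R * e <= u)%R%:R.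
    by rewrite /s big_ord_recr/= mulrDr.
  have nS : n.+1%:R * e = n%:R * e + e by rewrite -natr1 mulrDl mul1r.
  rewrite sS nS; have [h|h] := leP (n%:R * e + e) u; rewrite ?mulr1 ?mulr0 ?addr0.
    have sE : s n = n%:R * e by case: alt => // ?; apply/eqP; rewrite eq_le sn /=; lra.
    by rewrite sE; split=> //; right.
  split => //; first by lra.
  by case: alt => [|->]; left => //; lra.
have [su sn alt] := key N; rewrite -/(s N) ger0_norm ?subr_ge0//.
by case: alt => ?; lra.
Qed.

Lemma bounded_mfun_layers dS (S : measurableType dS) (R : realType)
    (m : S -> R) (e : R) : bounded_mfun m -> 0 < e ->
  exists N (c : R) (B : nat -> set S), (forall k, measurable (B k)) /\
    forall x, `|m x - (c + e * \sum_(k < N) \1_(B k) x)| <= e.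
Proof.
move=> /bounded_mfunP[mm [K K0 mK]] e0.
pose N := (Num.truncn (2 * K / e)).+1.
have NK : 2 * K <= N%:R * e by rewrite -ler_pdivrMr// ltW// truncnS_gt.
exists N, (- K), (fun k => [set x | k.+1%:R * e <= m x + K]); split => [k|x].
  rewrite (_ : mkset _ = m @^-1` `[k.+1%:R * e - K, +oo[).
    by rewrite -[X in measurable X]setTI; apply: mm.
  by apply/seteqP; split=> x /=; rewrite in_itv/= andbT lerBlDr.
have mKx := mK x; rewrite ler_norml in mKx; case/andP: mKx => mK1 mK2.
rewrite opprD opprK addrA; under eq_bigr do rewrite indicE.
have -> : \sum_(k < N) (x \in [set x | k.+1%:R * e <= m x + K]%R)%:R =
          \sum_(k < N) (k.+1%:R * e <= m x + K)%R%:R :> R.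
  apply: eq_bigr => k _; congr (_%:R); congr nat_of_bool.
  by have [h|h] := boolP (_ <= _); [rewrite mem_set|rewrite memNset//; exact/negP].
by apply: layer_sum => //; lra.
Qed.

Section multipliers.
Context d (T : measurableType d) (R : realType) (P : probability T R).
Context dS (S : measurableType dS) (X : nat -> T -> S).
Hypothesis iX : iid P X.

Lemma ulln_cst (c : R) : ulln P X [set cst c].
Proof.
split=> [h ->|e e0]; first exact: bounded_mfun_cst.
apply: vanishing_sub (vanishing0 P) _; exists 1%N => n n0 w [_ -> /=].
by rewrite smean_cst// pmean_cst subrr normr0 ltNge ltW.
Qed.

(** A bounded function is, up to e, a constant plus a multiple of a sum of
    indicators, and each of these multipliers is allowed by hypothesis. *)
Lemma ulln_multiplier (G : set (S -> R)) (K : R) (m : S -> R) :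
  (forall g x, G g -> `|g x| <= K) -> ulln P X G ->
  (forall B, measurable B -> ulln P X
     [set h | exists2 g, G g & h = fun x => \1_B x * g x]) ->
  bounded_mfun m ->
  ulln P X [set h | exists2 g, G g & h = fun x => m x * g x].
Proof.
have [mX _ _] := iX.
move=> GK uG uB bm; apply: ulln_approx => //.
  by move=> _ [g Gg ->]; apply: bounded_mfunM => //; exact: uG.1.
move=> e0 e00; have K1 : 0 < `|K| + 1 by rewrite ltr_wpDl.
have e1 : 0 < e0 / (`|K| + 1) by rewrite divr_gt0.
have [N [c [B [mB mcB]]]] := bounded_mfun_layers bm e1.
set e := e0 / _ in e1 mcB.
exists [set h | exists2 g, G g & h = fun x => (c + e * \sum_(k < N) \1_(B k) x) * g x].
exists [set cst e0]; split.
- have uS n : ulln P X [set h | exists2 g, G g &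
      h = fun x => (\sum_(k < n) \1_(B k) x) * g x].
    elim: n => [|n IH].
      apply: ulln_sub (ulln_cst 0) _ => _ [g Gg ->] /=.
      by apply/funext => x; rewrite big_ord0 mul0r.
    apply: ulln_sub (ullnD mX IH (uB _ (mB n))) _ => _ [g Gg ->].
    exists (fun x => (\sum_(k < n) \1_(B k) x) * g x), (fun x => \1_(B n) x * g x).
    split; [by exists g|by exists g|].
    by apply/funext => x; rewrite big_ord_recr/= mulrDl.
  apply: ulln_sub (ullnD mX (ullnZ mX c uG) (ullnZ mX e (uS N))) _ => _ [g Gg ->].
  exists (fun x => c * g x), (fun x => e * ((\sum_(k < N) \1_(B k) x) * g x)).
  split; [by exists g|by exists (fun x => (\sum_(k < N) \1_(B k) x) * g x) => //; exists g|].
  by apply/funext => x; rewrite mulrDl mulrA.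
- exact: ulln_cst.
- by move=> _ ->; rewrite pmean_cst.
move=> _ [g Gg ->]; eexists; exists (cst e0).
split; [by exists g|by []|move=> i w /=].
set x := X i w; rewrite -mulrBl normrM -[leRHS](divfK (lt0r_neq0 K1)) ler_pM//.
by rewrite (le_trans (GK _ x Gg))// (le_trans (ler_norm _))// lerDl.
Qed.

(** The ordinary weak law, as the multiplier rule applied to the class {1}. *)
Lemma ulln_bounded (m : S -> R) : bounded_mfun m -> ulln P X [set m].
Proof.
move=> bm; have := @ulln_multiplier [set cst 1] 1 m.
move=> /(_ _ (ulln_cst 1) _ bm) H; apply: ulln_sub (H _ _) _.
- by move=> g x ->; rewrite /= normr1.
- move=> B mB; apply: ulln_sub (ulln_indic iX mB) _ => _ [g -> ->] /=.
  by apply/funext => x; rewrite mulr1.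
- by move=> _ ->; exists (cst 1) => //; apply/funext => x; rewrite mulr1.
Qed.

(** Glivenko-Cantelli preservation under one bounded multiplier, which may
    depend on parts of the observation that the class does not see. *)
Lemma ulln_gc dV (SV : measurableType dV) (V : S -> SV) (F : set (SV -> R))
    (K : R) (m : S -> R) :
  measurable_fun setT V -> (forall f v, F f -> `|f v| <= K) ->
  glivenko_cantelli P (fun w => V (X 0%N w)) F -> bounded_mfun m ->
  ulln P X [set h | exists2 f, F f & h = fun x => m x * f (V x)].
Proof.
move=> mV FK gcF bm; pose G : set (S -> R) := [set h | exists2 f, F f & h = f \o V].
have uB B : measurable B -> ulln P X [set h | exists2 g, G g & h = fun x => \1_B x * g x].
  move=> mB; apply: ulln_sub (ulln_gc_indic iX mV FK gcF mB) _.
  by move=> _ [_ [f Ff ->] ->]; exists f.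
have uG : ulln P X G.
  apply: ulln_sub (uB setT measurableT) _ => _ [f Ff ->].
  exists (f \o V); first by exists f.
  by apply/funext => x; rewrite indicT mul1r.
have := @ulln_multiplier G K m.
move=> /(_ _ uG uB bm) H; apply: ulln_sub (H _) _.
  by move=> _ x [f Ff ->]; exact: FK.
by move=> _ [f Ff ->]; exists (f \o V) => //; exists f.
Qed.

End multipliers.

(** * Row vectors and small balls *)

Section row_vectors.
Context (R : realType) (n : nat).
Implicit Types u v : 'rV[R]_n.

Lemma rV_subE u v j : (u - v) ord0 j = u ord0 j - v ord0 j.
Proof. by rewrite !mxE. Qed.

Lemma coord_le_norm v j : `|v ord0 j| <= `|v|.
Proof.
rewrite [leRHS]/Num.norm /= mx_normrE; apply/bigmax_geP; right => /=.
by exists (ord0, j).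
Qed.

Lemma norm_rV_le v (c : R) : 0 <= c -> (forall j, `|v ord0 j| <= c) -> `|v| <= c.
Proof.
move=> c0 vc; rewrite [leLHS]/Num.norm /= mx_normrE; apply/bigmax_leP; split => //.
by move=> [i j] _ /=; rewrite (ord1 i).
Qed.

Lemma norm_rV_gt v (c : R) : 0 <= c -> c < `|v| -> exists j, c < `|v ord0 j|.
Proof.
move=> c0 cv; apply: contrapT => /forallNP H; move: cv.
rewrite ltNge norm_rV_le// => j; rewrite leNgt; exact/negP.
Qed.

Lemma norm_dotp_le u v : `|dotp u v| <= n%:R * (`|u| * `|v|).
Proof.
rewrite /dotp (le_trans (ler_norm_sum _ _ _))//.
rewrite mulr_natl -[X in _ *+ X](card_ord n) -sumr_const; apply: ler_sum => j _.
by rewrite normrM ler_pM// coord_le_norm.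
Qed.

Lemma dotpBl u v w : dotp (u - v) w = dotp u w - dotp v w.
Proof.
by rewrite /dotp -sumrB; apply: eq_bigr => j _; rewrite !mxE mulrBl.
Qed.

Lemma measurable_coord j : measurable_fun setT (fun v : 'rV[R]_n => v ord0 j).
Proof.
move=> _ A mA; rewrite setTI; apply: sub_sigma_algebra.
rewrite -bigcup_seq; exists j; first by rewrite /= mem_index_enum.
by exists A => //; rewrite setTI.
Qed.

Lemma measurable_dotp u : measurable_fun setT (dotp u).
Proof.
apply: measurable_sum => j; apply: measurable_funM; first exact: measurable_cst.
exact: measurable_coord.
Qed.

End row_vectors.

Section small_balls.
Context d (T : measurableType d) (R : realType) (P : probability T R).
Context dV (SV : measurableType dV).

(** Anti-concentration around a random centre without disintegration.  Slice the
    values of a (V) into cells of width e: on each cell the centre is known up to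
    e, so U lies in a fixed interval of length 3 e, and the hypothesis applies
    to the event that V is in the cell.  The cells are disjoint, so the
    probabilities of the second factor add up to at most 1. *)
Lemma small_ball (U : T -> R) (V : T -> SV) (a : SV -> R) (A L e : R) :
  measurable_fun setT U -> measurable_fun setT V -> measurable_fun setT a ->
  (forall w, `|a (V w)| <= A) -> 0 <= L -> 0 < e ->
  (forall x y B, x <= y -> measurable B ->
     (P (U @^-1` `[x, y] `&` V @^-1` B) <= (L * (y - x))%:E * P (V @^-1` B))%E) ->
  (P [set w | (`|U w - a (V w)| <= e)%R] <= (3 * L * e)%:E)%E.
Proof.
move=> mU mV ma aA L0 e0 dens.
pose N := (Num.truncn (2 * A / e)).+1.
have NA : 2 * A < N%:R * e by rewrite -ltr_pdivrMr// truncnS_gt.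
pose B k := [set v | k%:R * e <= a v + A] `&` [set v | a v + A < k.+1%:R * e].
have mB k : measurable (B k).
  rewrite /B (_ : _ `&` _ = a @^-1` `[k%:R * e - A, k.+1%:R * e - A[).
    by rewrite -[X in measurable X]setTI; apply: ma.
  by apply/seteqP; split=> x /=; rewrite in_itv/= lerBlDr ltrBrDr;
      [move=> [-> ->]|move=> /andP[]].
have mVB k : measurable (V @^-1` B k).
  by rewrite -[X in measurable X]setTI; apply: mV.
pose x k := k%:R * e - A - e; pose y k := k.+1%:R * e - A + e.
have xy k : y k - x k = 3 * e by rewrite /x /y -natr1; ring.
have mUi k : measurable (U @^-1` `[x k, y k]).
  by rewrite -[X in measurable X]setTI; apply: mU.
pose D := [set w | `|U w - a (V w)| <= e].
have DE : D `<=` \big[setU/set0]_(k < N) (U @^-1` `[x k, y k] `&` V @^-1` B k).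
  rewrite -(bigcup_mkord N (fun k => U @^-1` `[x k, y k] `&` V @^-1` B k)) => w Dw.
  have := aA w; rewrite ler_norml => /andP[a1 a2].
  have v0 : 0 <= (a (V w) + A) / e by rewrite divr_ge0 ?(ltW e0)//; lra.
  have /andP[k1 k2] := truncn_itv v0.
  move: k1 k2; set k := Num.truncn _ => k1 k2.
  rewrite ler_pdivlMr// in k1; rewrite ltr_pdivrMr// in k2.
  exists k => /=.
    rewrite -(ltr_nat R) -(ltr_pM2r e0) (le_lt_trans k1)//; lra.
  move: Dw; rewrite /D /= ler_norml => /andP[? ?].
  split; last by split.
  rewrite in_itv/= /x /y; apply/andP; split; lra.
have mD : measurable D.
  rewrite (_ : D = (fun w => U w - a (V w)) @^-1` `[- e, e]).
    rewrite -[X in measurable X]setTI; apply: measurable_funB => //.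
    exact: measurableT_comp.
  by apply/seteqP; split=> w /=; rewrite /D /= in_itv/= ler_norml.
have mE k : measurable (U @^-1` `[x k, y k] `&` V @^-1` B k) by exact: measurableI.
apply: (@le_trans _ _ (P (\big[setU/set0]_(k < N) (U @^-1` `[x k, y k] `&` V @^-1` B k)))).
  by apply: le_measure DE; rewrite inE//; exact: bigsetU_measurable.
apply: (@le_trans _ _ (\sum_(k < N) P (U @^-1` `[x k, y k] `&` V @^-1` B k))%E).
  by apply: (Boole_inequality P (A := fun k => U @^-1` `[x k, y k] `&` V @^-1` B k)).
apply: (@le_trans _ _ (\sum_(k < N) (3 * L * e)%:E * P (V @^-1` B k))%E).
  apply: lee_sum => k _; have := dens (x k) (y k) (B k).
  rewrite xy => H; rewrite (le_trans (H _ _))//.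
    by rewrite -subr_ge0 xy mulr_ge0// ltW.
  by rewrite mulrCA mulrA.
rewrite -ge0_sume_distrr//.
rewrite -[leRHS]mule1; apply: lee_wpmul2l.
  by rewrite lee_fin !mulr_ge0// ltW.
rewrite -(measure_bigsetU P (F := fun k => V @^-1` B k))//.
  by apply: probability_le1; exact: bigsetU_measurable.
apply/trivIsetP => i j _ _; apply: contra_neqP => /eqP/set0P[w [[] /= i1 i2 [] /= j1 j2]].
have [] : (i < j.+1)%N /\ (j < i.+1)%N.
  split; rewrite -(ltr_nat R) -(ltr_pM2r e0).
    exact: le_lt_trans i1 j2.
  exact: le_lt_trans j1 i2.
by rewrite !ltnS => ij ji; apply/eqP; rewrite eqn_leq ij.
Qed.

End small_balls.

(** * Conditional expectation 1, truncation and densities *)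

Section cond_exp.
Context d (T : measurableType d) (R : realType) (P : probability T R).
Context dS (S : measurableType dS) (X : T -> S).

(** The definition of conditional expectation gives this for indicators phi,
    hence for staircases, hence up to any e by uniform approximation. *)
Lemma cond_exp1_mul (W : T -> R) (phi : S -> R) :
  measurable_fun setT X -> bounded_mfun W -> is_cond_exp P X W (cst 1) ->
  bounded_mfun phi ->
  \int[P]_w (W w * phi (X w)) = \int[P]_w phi (X w).
Proof.
move=> mX bW [_ _ _ condW] bphi.
have indic B : measurable B ->
    \int[P]_w (W w * \1_B (X w)) = \int[P]_w \1_B (X w).
  move=> mB; have resE (f : T -> R) : \int[P]_w (f w * \1_B (X w)) =
      fine (\int[P]_(w in X @^-1` B) (f w)%:E).
    rewrite -[RHS]/(\int[P]_(w in X @^-1` B) f w) [RHS]Rintegral_mkcond.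
    apply: eq_Rintegral => w _; rewrite patchE indicE.
    rewrite (_ : (w \in X @^-1` B) = (X w \in B)).
      by case: ifP; rewrite ?mulr1 ?mulr0.
    by apply/idP/idP; rewrite !inE.
  rewrite resE condW// -(resE (cst 1)).
  by apply: eq_Rintegral => w _; rewrite /= mul1r.
have [_ [K K0 WK]] := bounded_mfunP bW.
have K1 : 0 < K + 1 by rewrite addr_gt0.
apply/eqP; rewrite -subr_eq0 -normr_le0; apply/ler_addgt0Pl => e0 e00.
rewrite addr0; have e1 : 0 < e0 / (K + 1) by rewrite divr_gt0.
have [N [c [B [mB phiB]]]] := bounded_mfun_layers bphi e1.
set e := e0 / _ in e1 phiB.
pose psi x := c + e * \sum_(k < N) \1_(B k) x.
have bsum : bounded_mfun (fun x => \sum_(k < N) \1_(B k) x : R).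
  by apply: bounded_mfun_sum => k; exact: bounded_mfun_indic.
have bpsi : bounded_mfun psi.
  by apply: bounded_mfunD; [exact: bounded_mfun_cst|exact: bounded_mfunZ].
have bX (f : S -> R) : bounded_mfun f -> bounded_mfun (fun w => f (X w)).
  exact: bounded_mfun_comp.
have W1 : \int[P]_w W w = 1.
  have := indic setT measurableT.
  under eq_Rintegral do rewrite indicT mulr1.
  under [RHS]eq_Rintegral do rewrite indicT.
  by move=> ->; exact: expect_cst.
have Epsi : \int[P]_w (W w * psi (X w)) = \int[P]_w psi (X w).
  have -> : (fun w => W w * psi (X w)) = (fun w => c * W w +
      e * \sum_(k < N) (W w * \1_(B k) (X w))).
    by apply/funext => w; rewrite /psi mulrDr -mulr_sumr; ring.
  have bWB k : bounded_mfun (fun w => W w * \1_(B k) (X w)).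
    by apply: bounded_mfunM => //; apply: bX; exact: bounded_mfun_indic.
  have bXs : bounded_mfun (fun w => \sum_(k < N) \1_(B k) (X w) : R) by exact: (bX _ bsum).
  have bWs : bounded_mfun (fun w => \sum_(k < N) (W w * \1_(B k) (X w)) : R).
    exact: bounded_mfun_sum.
  rewrite expectD; [|exact: bounded_mfunZ|exact: bounded_mfunZ].
  rewrite expectD; [|exact: bounded_mfun_cst|exact: bounded_mfunZ].
  rewrite expect_cst !expectZ// W1 mulr1 !expect_sum//; last first.
    by move=> k; apply: bX; exact: bounded_mfun_indic.
  by congr (_ + _ * _); apply: eq_bigr => k _; exact: indic.
have bWp : bounded_mfun (fun w => W w * phi (X w)).
  by apply: bounded_mfunM => //; exact: bX.
have bWs : bounded_mfun (fun w => W w * psi (X w)).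
  by apply: bounded_mfunM => //; exact: bX.
have -> : \int[P]_w (W w * phi (X w)) - \int[P]_w phi (X w) =
  \int[P]_w (W w * phi (X w) - W w * psi (X w)) -
  \int[P]_w (phi (X w) - psi (X w)).
  rewrite (expectB P bWp bWs) (expectB P (bX _ bphi) (bX _ bpsi)) Epsi; ring.
rewrite (le_trans (ler_normB _ _))// [leRHS](_ : _ = K * e + e); last first.
  by rewrite -[X in _ + X]mul1r -mulrDl /e mulrCA divff ?mulr1// gt_eqF.
apply: lerD; apply: norm_expect_le.
- exact: bounded_mfunB.
- by move=> w; rewrite -mulrBr normrM ler_pM.
- by apply: bounded_mfunB; exact: bX.
- by move=> w; exact: phiB.
Qed.

End cond_exp.

Section clip.
Context (R : realType).
(** Weights and covariates are bounded along the sample but not as coordinate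
    functions of the observation; truncating these at the bound makes them
    bounded everywhere without changing their values on the sample. *)
Definition clip (K r : R) := Num.max (- K) (Num.min r K).

Lemma norm_clip K r : 0 <= K -> `|clip K r| <= K.
Proof.
move=> K0; rewrite ler_norml /clip le_max lexx/= ge_max ge_min lexx orbT andbT.
by rewrite (le_trans _ K0)// oppr_le0.
Qed.

Lemma clip_id K r : `|r| <= K -> clip K r = r.
Proof.
rewrite ler_norml /clip => /andP[r1 r2].
by rewrite (min_idPl r2); apply/max_idPr.
Qed.

Lemma bounded_mfun_clip d (T : measurableType d) (f : T -> R) K : 0 <= K ->
  measurable_fun setT f -> bounded_mfun (fun x => clip K (f x)).
Proof.
move=> K0 mf; split; last by exists K => x; exact: norm_clip.
apply: measurable_maxr; first exact: measurable_cst.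
by apply: measurable_minr => //; exact: measurable_cst.
Qed.

End clip.

Section densities.
Context d (T : measurableType d) (R : realType) (P : probability T R).

Lemma density_interval (U : T -> R) (f : R -> R) (L x y : R) :
  is_density P U f -> 0 <= L -> (forall t, f t <= L) -> x <= y ->
  (P (U @^-1` `[x, y]) <= (L * (y - x))%:E)%E.
Proof.
move=> [mf f0 fE] L0 fL xy; rewrite fE//.
apply: (@le_trans _ _ (\int[lebesgue_measure]_(t in `[x, y]) (cst L%:E) t)%E).
  apply: ge0_le_integral => //=.
  - by move=> t _; rewrite lee_fin f0.
  - by apply/measurable_EFinP; exact: measurable_funTS.
  - by move=> t _; rewrite lee_fin.
rewrite integral_cst//= lebesgue_measure_itv/= lte_fin.
move: xy; rewrite le_eqVlt => /predU1P[->|xy].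
  by rewrite ltxx mule0 subrr mulr0.
by rewrite xy -EFinD -EFinM.
Qed.

Lemma cond_density_interval dV (SV : measurableType dV) (U : T -> R)
    (V : T -> SV) (g : SV -> R -> R) (L x y : R) (B : set SV) :
  measurable_fun setT V -> is_cond_density P U V g ->
  0 <= L -> (forall z t, g z t <= L) -> x <= y -> measurable B ->
  (P (U @^-1` `[x, y] `&` V @^-1` B) <= (L * (y - x))%:E * P (V @^-1` B))%E.
Proof.
move=> mV [mg g0 gE] L0 gL xy mB; rewrite gE//.
have mVB : measurable (V @^-1` B) by rewrite -[X in measurable X]setTI; exact: mV.
have mgz z : measurable_fun setT (g z).
  by have := measurable_fun_pair2 z mg.
rewrite -integral_cst//; apply: ge0_le_integral => //.
- by move=> w _; apply: integral_ge0 => t _; rewrite lee_fin.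
- pose G (p : SV * R) : \bar R := (g p.1 p.2 * \1_(`[x, y]) p.2)%:E.
  have mG : measurable_fun setT G.
    apply/measurable_EFinP; apply: measurable_funM => //.
    by apply: (measurableT_comp _ measurable_snd); exact: measurable_indic.
  have G0 p : (0 <= G p)%E by rewrite lee_fin mulr_ge0// indicE.
  have := measurable_fun_fubini_tonelli_F (m2 := @lebesgue_measure R) G mG G0.
  move=> /measurableT_comp/(_ mV) H.
  apply: measurable_funTS; apply: eq_measurable_fun H => w _ /=.
  rewrite /fubini_F [RHS]integral_mkcond; apply: eq_integral => t _.
  by rewrite /G /= patchE indicE; case: ifP; rewrite ?mulr1 ?mulr0.
- move=> w _ /=.
  apply: (@le_trans _ _ (\int[lebesgue_measure]_(t in `[x, y]) (cst L%:E) t)%E).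
    apply: ge0_le_integral => //=.
    + by move=> t _; rewrite lee_fin g0.
    + by apply/measurable_EFinP; apply: measurable_funTS; exact: mgz.
    + by move=> t _; rewrite lee_fin.
  rewrite integral_cst//= lebesgue_measure_itv/= lte_fin.
  move: xy; rewrite le_eqVlt => /predU1P[->|xy].
    by rewrite ltxx mule0 subrr mulr0.
  by rewrite xy -EFinD -EFinM.
Qed.

End densities.

(** * Residuals have no concentrated mass *)

Section aft_continuity.
Context d (T : measurableType d) (R : realType) (P : probability T R).
Context (d1 d2 : nat) (s : aft_sample P d1 d2).
Local Notation vec := 'rV[R]_(d1 + d2).

Lemma measurable_resid (theta : vec) i : measurable_fun setT (resid s theta i).
Proof.
apply: measurable_funB; first exact: measurable_minr.
by apply: (measurableT_comp (measurable_dotp theta)).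
Qed.

(** Y is the failure time or the censoring time, so a residual near t puts
    either the error or the censoring time near an affine function of Z.  The
    error is independent of Z and has a bounded density; the censoring time has
    a bounded conditional density given Z. *)
Lemma resid_small_ball (theta0 : vec) :
  aft_model s theta0 -> bounded_covariate s -> regular_error_density s ->
  bounded_censoring_density s ->
  exists2 c : R, 0 < c & forall theta t e, 0 < e ->
    (P [set w | (`|resid s theta 0%N w - t| <= e)%R] <= (c * e)%:E)%E.
Proof.
move=> [failE _ ind _] [M ZM] [f [fdens _ [K1 fK1] _]] [g [K2 [gdens gK2]]].
pose L := `|K1| + `|K2| + 1.
have L0 : 0 < L by rewrite ltr_wpDl// addr_ge0.
have fL t : f t <= L.
  have [fK _] := fK1 t; have := ler_norm (f t); have := ler_norm K1.
  by have := normr_ge0 K2; rewrite /L; lra.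
have gL z t : g z t <= L.
  have := gK2 z t; have := ler_norm K2; have := normr_ge0 K1.
  by rewrite /L; lra.
(* 3 L for the error plus 3 L for the censoring time. *)
exists (6 * L) => [|theta t e e0]; first by rewrite mulr_gt0.
pose A := `|t| + (d1 + d2)%:R * (`|theta| * M) + (d1 + d2)%:R * (`|theta0| * M).
have dotM (u : vec) w : `|dotp u (covz s 0%N w)| <= (d1 + d2)%:R * (`|u| * M).
  by rewrite (le_trans (norm_dotp_le _ _))// ler_wpM2l// ler_wpM2l.
have M0 (u : vec) (w : T) : 0 <= (d1 + d2)%:R * (`|u| * M).
  exact: (le_trans (normr_ge0 _) (dotM u w)).
pose a1 z := t + dotp theta z - dotp theta0 z.
pose a2 z := t + dotp theta z.
have ma2 : measurable_fun setT a2.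
  by apply: measurable_funD; [exact: measurable_cst|exact: measurable_dotp].
have ma1 : measurable_fun setT a1.
  by apply: measurable_funB => //; exact: measurable_dotp.
have a1A w : `|a1 (covz s 0%N w)| <= A.
  rewrite /a1 (le_trans (ler_normB _ _))// lerD//.
  by rewrite (le_trans (ler_normD _ _))// lerD.
have a2A w : `|a2 (covz s 0%N w)| <= A.
  rewrite /a2 (le_trans (ler_normD _ _))// /A -addrA lerD// ler_wpDr//.
  exact: (M0 theta0 w).
have errB x y B : x <= y -> measurable B ->
    (P (err s 0%N @^-1` `[x, y] `&` covz s 0%N @^-1` B)
     <= (L * (y - x))%:E * P (covz s 0%N @^-1` B))%E.
  move=> xy mB; have := ind 0%N `[x, y]%classic (B `*` setT).
  rewrite (_ : _ @^-1` (B `*` setT) = covz s 0%N @^-1` B); last first.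
    by apply/seteqP; split=> w //= [].
  move=> -> //; last exact: measurableX.
  rewrite lee_wpmul2r//; apply: density_interval (fdens 0%N) _ fL xy.
  exact: ltW.
have censB x y B : x <= y -> measurable B ->
    (P (cens s 0%N @^-1` `[x, y] `&` covz s 0%N @^-1` B)
     <= (L * (y - x))%:E * P (covz s 0%N @^-1` B))%E.
  move=> xy mB; apply: cond_density_interval gdens _ gL xy mB => //.
  exact: ltW.
have mE (a : vec -> R) (U : {RV P >-> R}) : measurable_fun setT a ->
    measurable [set w | `|U w - a (covz s 0%N w)| <= e].
  move=> ma; rewrite (_ : mkset _ = (fun w => U w - a (covz s 0%N w)) @^-1` `[- e, e]).
    rewrite -[X in measurable X]setTI; apply: measurable_funB => //.
    exact: measurableT_comp.
  by apply/seteqP; split=> w /=; rewrite in_itv/= ler_norml.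
have mZ := measurable_funPT (covz s 0%N).
have b1 := small_ball (measurable_funPT (err s 0%N)) mZ ma1 a1A (ltW L0) e0 errB.
have b2 := small_ball (measurable_funPT (cens s 0%N)) mZ ma2 a2A (ltW L0) e0 censB.
have mr : measurable [set w | `|resid s theta 0%N w - t| <= e].
  rewrite (_ : mkset _ = (fun w => resid s theta 0%N w - t) @^-1` `[- e, e]).
    rewrite -[X in measurable X]setTI; apply: measurable_funB => //.
    exact: measurable_resid.
  by apply/seteqP; split=> w /=; rewrite in_itv/= ler_norml.
apply: (@le_trans _ _ (P ([set w | `|err s 0%N w - a1 (covz s 0%N w)| <= e] `|`
   [set w | `|cens s 0%N w - a2 (covz s 0%N w)| <= e]))).
  apply: le_measure; rewrite ?inE//; first by apply: measurableU; exact: mE.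
  move=> w /=; rewrite /resid /obsY /a1 /a2 => h.
  have [fc|cf] := leP (failt s 0%N w) (cens s 0%N w).
    left; move: h; rewrite (min_idPl fc) failE; congr (`|_| <= _); ring.
  right; move: h; rewrite (min_idPr (ltW cf)); congr (`|_| <= _); ring.
apply: le_trans (measureU2 P (mE _ _ ma1) (mE _ _ ma2)) _.
rewrite (_ : 6 * L * e = 3 * L * e + 3 * L * e); last by ring.
by rewrite EFinD leeD.
Qed.

End aft_continuity.

(** * Compactness and tightness *)

Section compactness.
Context (R : realType) (V : normedModType R).

Lemma compact_net (A : set V) (r : R) : compact A -> 0 < r ->
  exists s : seq V, (forall y, y \in s -> A y) /\
    forall x, A x -> exists2 y, y \in s & `|x - y| <= r.
Proof.
move=> + r0; rewrite compact_cover => cA.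
have [|x Ax|D DA cov] := cA V A (fun y => (ball y r)°).
- by move=> y _; exact: open_interior.
- by exists x => //; rewrite /interior; exact: nbhsx_ballx.
exists (finmap.enum_fset D); split => [y /DA|x /cov[y yD]]; first exact: set_mem.
move=> /interior_subset; rewrite -ball_normE /= => xy.
by exists y => //; rewrite distrC ltW.
Qed.

End compactness.

Section criterion_separation.
Context (R : realType) (n : nat).
Local Notation vec := 'rV[R]_n.

(** The points of A at distance at least e from x0 form a compact set whose
    image is closed and misses 0, hence misses a ball around 0. *)
Lemma unique_zero_separated (A : set vec) (f : vec -> vec) (x0 : vec) (e : R) :
  compact A -> {within A, continuous f} ->
  (forall x, A x -> f x = 0 -> x = x0) -> 0 < e ->
  exists2 m : R, 0 < m & forall x, A x -> e <= `|x - x0| -> m <= `|f x|.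
Proof.
move=> cA cf uniq e0; pose C := A `&` [set x | e <= `|x - x0|].
have clo : closed [set x : vec | e <= `|x - x0|].
  rewrite (_ : mkset _ = (fun x : vec => `|x - x0|) @^-1` [set y | e <= y])//.
  apply: preimage_closed; last exact: closed_ge.
  move=> x _; apply: (@continuous_comp _ _ _ (fun x : vec => x - x0) Num.norm).
    by apply: continuousB; [exact: cvg_id|exact: cst_continuous].
  exact: norm_continuous.
have cC : compact C by exact: compact_closedI.
have cfC : compact (f @` C).
  apply: continuous_compact => //; apply: continuous_subspaceW cf.
  by move=> x [].
have : closed (f @` C) by apply: compact_closed => //; exact: norm_hausdorff.
move=> /closed_openC; rewrite openE => /(_ 0) H.
have : (~` (f @` C)) 0.
  move=> [x [Ax xe] fx0]; have := uniq x Ax fx0 => xx0.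
  by move: xe; rewrite /= xx0 subrr normr0 leNgt e0.
move=> /H; rewrite /interior => /nbhs_ballP[m /= m0 mC]; exists m => // x Ax ex.
rewrite leNgt; apply/negP => fm; have /mC : ball 0 m (f x).
  by rewrite -ball_normE /= sub0r normrN.
by apply; exists x.
Qed.

End criterion_separation.

Section tightness.
Context d (T : measurableType d) (R : realType) (P : probability T R).

Lemma tight (U : T -> R) (e : R) : measurable_fun setT U -> 0 < e ->
  exists2 L : R, 0 < L & (P [set w | (L <= `|U w|)%R] <= e%:E)%E.
Proof.
move=> mU e0; pose F n := [set w | n%:R <= `|U w|].
have mF n : measurable (F n).
  rewrite (_ : F n = (fun w => `|U w|) @^-1` `[n%:R, +oo[).
    rewrite -[X in measurable X]setTI.
    by apply: (measurableT_comp (@normr_measurable R setT) mU).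
  by apply/seteqP; split=> w /=; rewrite in_itv/= andbT.
have F0 : \bigcap_n F n = set0.
  apply/seteqP; split=> // w Fw; have := Fw (Num.truncn `|U w|).+1 I.
  by rewrite /F /= leNgt truncnS_gt.
have := nonincreasing_cvg_mu (mu := P) (F := F).
rewrite F0 measure0 => cF.
have {}cF : P \o F @ \oo --> 0%E.
  apply: cF => //.
  - by rewrite -ge0_fin_numE//; exact: fin_num_measure.
  - move=> m n mn; apply/subsetPset => w; rewrite /F /=.
    by apply: le_trans; rewrite ler_nat.
have e1 : (0%E < e%:E)%E by rewrite lte_fin.
have [N _ HN] := cF [set y | (y < e%:E)%E] (open_ereal_lt' e1).
exists N.+1%:R => //; apply: ltW; exact: (HN N.+1 (leqnSn N)).
Qed.

End tightness.

(** * The estimating function *)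

(** Two at-risk indicators can differ only if the residual is within e of the
    threshold, e bounding the total displacement of both. *)
Lemma risk_diff (R : realType) (t t' r r' e : R) :
  `|t - t'| + `|r - r'| <= e ->
  `|(t <= r)%R%:R - (t' <= r')%R%:R| <= (`|r - t| <= e)%R%:R :> R.
Proof.
move=> H; have := normr_ge0 (t - t'); have := normr_ge0 (r - r').
have := ler_norm (t - t'); have := ler_norm (r - r').
have := ler_norm (t' - t); have := ler_norm (r' - r).
rewrite (distrC r') (distrC t') => a1 a2 a3 a4 a5 a6.
have near : (t <= r) != (t' <= r') -> `|r - t| <= e.
  rewrite ler_norml.
  have [tr|tr] := leP t r; have [tr'|tr'] := leP t' r' => // _; lra.
have [->|/near ->] := eqVneq (t <= r) (t' <= r').
  by rewrite subrr normr0 ler0n.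
by case: (t <= r); case: (t' <= r'); rewrite ?subrr ?subr0 ?sub0r ?normrN ?normr1 ?normr0.
Qed.

(** The modulus is only asked for e > 0, as this is what bounds on probabilities
    of balls of radius e provide. *)
Lemma modulus_continuous (R : realType) (f : R -> R) (L : R) : 0 < L ->
  (forall t t' e, 0 < e -> `|t - t'| <= e -> `|f t - f t'| <= L * e) ->
  continuous f.
Proof.
move=> L0 fL t; apply/cvgrPdist_le => e e0; have eL : 0 < e / L by rewrite divr_gt0.
have LeL : L * (e / L) = e by rewrite mulrCA divff ?mulr1// gt_eqF.
near=> t'; rewrite -[leRHS]LeL; apply: fL => //.
Unshelve. all: by end_near. Qed.

Section criterion.
Context d (T : measurableType d) (R : realType) (P : probability T R).
Context (d1 d2 : nat) (s : aft_sample P d1 d2).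
Local Notation vec := 'rV[R]_(d1 + d2).
Local Notation rec := (R * bool * vec)%type.
Local Notation obs := (R * bool * vec * bool * R * R)%type.
Variables (K c : R).
Hypotheses (K0 : 0 < K) (c0 : 0 < c) (iX : iid P (obs_full s)).
Hypothesis OK : forall i w, `|wOmega s i w| <= K.
Hypothesis WK : forall i w, `|wW s i w| <= K.
Hypothesis ZK : forall i w, `|covz s i w| <= K.
Hypothesis ball : forall theta t e, 0 < e ->
  (P [set w | (`|resid s theta 0%N w - t| <= e)%R] <= (c * e)%:E)%E.
Hypothesis condO : forall phi : rec -> R, bounded_mfun phi ->
  \int[P]_w (wOmega s 0%N w * phi (obsX s 0%N w)) = \int[P]_w phi (obsX s 0%N w).
Hypothesis condW : forall phi : rec -> R, bounded_mfun phi ->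
  \int[P]_w (wW s 0%N w * phi (obsX s 0%N w)) = \int[P]_w phi (obsX s 0%N w).

(* Residuals are A-Lipschitz in theta, the covariates being bounded by K. *)
Let A := (d1 + d2)%:R * K.
Let A0 : 0 <= A. Proof. by rewrite mulr_ge0// ltW. Qed.

Definition obs_core (x : obs) : rec := x.1.1.1.
Definition core_resid (theta : vec) (y : rec) : R := y.1.1 - dotp theta y.2.
Definition core_cov j (y : rec) : R := clip K (y.2 ord0 j).
Definition core_uncens (y : rec) : R := (y.1.2)%:R.
Definition obs_Omega (x : obs) : R := clip K x.1.2.
Definition obs_W (x : obs) : R := clip K x.2.
Definition core_risk t theta (y : rec) : R := (t <= core_resid theta y)%R%:R.

Lemma measurable_obs_core : measurable_fun setT obs_core.
Proof.
apply: (measurableT_comp measurable_fst); apply: (measurableT_comp measurable_fst).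
exact: measurable_fst.
Qed.

Lemma measurable_obsX : measurable_fun setT (obsX s 0%N).
Proof. by have [mX _ _] := iX; apply: (measurableT_comp measurable_obs_core (mX 0%N)). Qed.

Lemma measurable_core_resid theta : measurable_fun setT (core_resid theta).
Proof.
apply: measurable_funB.
  by apply: (measurableT_comp measurable_fst); exact: measurable_fst.
by apply: (measurableT_comp (measurable_dotp theta)); exact: measurable_snd.
Qed.

Lemma bounded_obs_Omega : bounded_mfun obs_Omega.
Proof.
apply: bounded_mfun_clip; first exact: ltW.
by apply: (measurableT_comp measurable_snd); exact: measurable_fst.
Qed.

Lemma bounded_obs_W : bounded_mfun obs_W.
Proof. by apply: bounded_mfun_clip; [exact: ltW|exact: measurable_snd]. Qed.

Lemma bounded_core_cov j : bounded_mfun (core_cov j).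
Proof.
apply: bounded_mfun_clip; first exact: ltW.
by apply: (measurableT_comp (measurable_coord j)); exact: measurable_snd.
Qed.

Lemma bounded_core_uncens : bounded_mfun core_uncens.
Proof.
apply: bounded_mfun_bool; apply: (measurableT_comp measurable_snd).
exact: measurable_fst.
Qed.

Lemma bounded_core_risk t theta : bounded_mfun (core_risk t theta).
Proof.
apply: bounded_mfun_bool; apply: measurable_fun_ler.
  exact: measurable_cst.
exact: measurable_core_resid.
Qed.

Lemma bounded_core (h : rec -> R) :
  bounded_mfun h -> bounded_mfun (fun x => h (obs_core x)).
Proof. exact: (bounded_mfun_comp measurable_obs_core). Qed.

Lemma bounded_obsX (h : rec -> R) :
  bounded_mfun h -> bounded_mfun (fun w => h (obsX s 0%N w)).
Proof. exact: (bounded_mfun_comp measurable_obsX). Qed.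

Lemma core_residE theta i w : core_resid theta (obs_core (obs_full s i w)) = resid s theta i w.
Proof. by []. Qed.

Lemma core_covE j i w : core_cov j (obs_core (obs_full s i w)) = covz s i w ord0 j.
Proof. by rewrite /core_cov clip_id// (le_trans (coord_le_norm _ _))// ZK. Qed.

Lemma obs_OmegaE i w : obs_Omega (obs_full s i w) = wOmega s i w.
Proof. by rewrite /obs_Omega clip_id// OK. Qed.

Lemma obs_WE i w : obs_W (obs_full s i w) = wW s i w.
Proof. by rewrite /obs_W clip_id// WK. Qed.

Lemma norm_core_cov j y : `|core_cov j y| <= K.
Proof. by rewrite norm_clip// ltW. Qed.

Lemma resid_diff theta theta' i w :
  `|resid s theta i w - resid s theta' i w| <= A * `|theta - theta'|.
Proof.
rewrite (_ : _ - _ = - dotp (theta - theta') (covz s i w)); last first.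
  by rewrite dotpBl /resid; ring.
rewrite normrN (le_trans (norm_dotp_le _ _))// /A -mulrA ler_wpM2l//.
by rewrite mulrC ler_wpM2r.
Qed.

Lemma measurable_near theta t (e : R) :
  measurable_fun setT (fun y => `|core_resid theta y - t| <= e).
Proof.
apply: measurable_fun_ler; last exact: measurable_cst.
apply: (measurableT_comp (@normr_measurable R setT)).
by apply: measurable_funB; [exact: measurable_core_resid|exact: measurable_cst].
Qed.

Lemma expect_near theta t (e : R) : 0 < e ->
  \int[P]_w ((`|resid s theta 0%N w - t| <= e)%R%:R) <= c * e.
Proof.
move=> e0; have mn := measurableT_comp (measurable_near theta t e) measurable_obsX.
rewrite expect_bool// -lee_fin fine_probE; first exact: ball.
exact: measurable_set_bool.
Qed.

(** The numerator of eta0: the mean of the j-th covariate over those at risk. *)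
Definition risk_cov j t theta : R :=
  \int[P]_w ((at_risk s t theta 0%N w)%:R * covz s 0%N w ord0 j).

Let bounded_at_risk t theta :
  bounded_mfun (fun w => (at_risk s t theta 0%N w)%:R : R).
Proof. by have := bounded_obsX (bounded_core_risk t theta). Qed.

Let bounded_covz j : bounded_mfun (fun w => covz s 0%N w ord0 j).
Proof.
have := bounded_obsX (bounded_core_cov j).
by under [X in bounded_mfun X -> _]funext do rewrite (core_covE j 0%N).
Qed.

Lemma measurable_at_risk t theta : measurable_fun setT (at_risk s t theta 0%N).
Proof.
apply: measurable_fun_ler; first exact: measurable_cst.
exact: measurable_resid.
Qed.

Lemma survE t theta : surv s t theta = \int[P]_w (at_risk s t theta 0%N w)%:R.
Proof.
by rewrite expect_bool//; exact: measurable_at_risk.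
Qed.

Lemma surv_ge0 t theta : 0 <= surv s t theta.
Proof. exact: fine_ge0. Qed.

Lemma surv_le1 t theta : surv s t theta <= 1.
Proof.
rewrite survE (le_trans (ler_norm _))//; apply: norm_expect_le => // w.
by case: at_risk; rewrite ?normr1 ?normr0.
Qed.

Lemma norm_risk_cov_le j t theta : `|risk_cov j t theta| <= K * surv s t theta.
Proof.
rewrite survE -expectZ//; apply: le_norm_expect; first exact: bounded_mfunM.
  exact: bounded_mfunZ.
move=> w; rewrite normrM mulrC ler_pM//.
  by rewrite (le_trans (coord_le_norm _ _))// ZK.
by case: at_risk; rewrite ?normr1 ?normr0.
Qed.

Lemma eta0E t theta j :
  eta0 s t theta ord0 j = (surv s t theta)^-1 * risk_cov j t theta.
Proof. by rewrite /eta0 !mxE survE. Qed.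

(** Valid at S = 0 too, where the convention 0/0 = 0 is harmless because the
    numerator is dominated by K S. *)
Lemma surv_eta0 t theta j : surv s t theta * eta0 s t theta ord0 j = risk_cov j t theta.
Proof.
rewrite eta0E; have [S0|S0] := eqVneq (surv s t theta) 0; last by rewrite mulVKf.
have := norm_risk_cov_le j t theta.
by rewrite S0 mul0r mulr0 normr_le0 => /eqP ->.
Qed.

Lemma norm_eta0_le t theta j : `|eta0 s t theta ord0 j| <= K.
Proof.
have [S0|S0] := eqVneq (surv s t theta) 0.
  by rewrite eta0E S0 invr0 mul0r normr0 ltW.
have Sp : 0 < surv s t theta by rewrite lt0r S0 surv_ge0.
rewrite -(ler_pM2l Sp) -[X in X * _ <= _](gtr0_norm Sp) -normrM surv_eta0 mulrC.
exact: norm_risk_cov_le.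
Qed.

Lemma surv_modulus t theta t' theta' (e : R) : 0 < e ->
  `|t - t'| + A * `|theta - theta'| <= e ->
  `|surv s t theta - surv s t' theta'| <= c * e.
Proof.
move=> e0 te; rewrite !survE -expectB//.
rewrite (le_trans _ (expect_near theta t e0))//; apply: le_norm_expect.
- exact: bounded_mfunB.
- apply: (bounded_obsX (h := fun y => (`|core_resid theta y - t| <= e)%R%:R)).
  by apply: bounded_mfun_bool; exact: measurable_near.
- move=> w; apply: risk_diff; rewrite (le_trans _ te)// lerD2l.
  exact: resid_diff.
Qed.

Lemma risk_cov_modulus j t theta t' theta' (e : R) : 0 < e ->
  `|t - t'| + A * `|theta - theta'| <= e ->
  `|risk_cov j t theta - risk_cov j t' theta'| <= K * (c * e).
Proof.
move=> e0 te; rewrite /risk_cov -expectB; [|exact: bounded_mfunM|exact: bounded_mfunM].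
have bn : bounded_mfun (fun w => (`|resid s theta 0%N w - t| <= e)%R%:R : R).
  apply: (bounded_obsX (h := fun y => (`|core_resid theta y - t| <= e)%R%:R)).
  by apply: bounded_mfun_bool; exact: measurable_near.
apply: le_trans (_ : _ <= K * \int[P]_w ((`|resid s theta 0%N w - t| <= e)%R%:R)) _;
  last by rewrite ler_pM2l// expect_near.
rewrite -expectZ//; apply: le_norm_expect.
- by apply: bounded_mfunB; exact: bounded_mfunM.
- exact: bounded_mfunZ.
- move=> w; rewrite -mulrBl normrM mulrC ler_pM//.
    by rewrite (le_trans (coord_le_norm _ _))// ZK.
  by apply: risk_diff; rewrite (le_trans _ te)// lerD2l; exact: resid_diff.
Qed.

(** The ratio is controlled only where the second of the two denominators is at least k;
    multiplying by that denominator leaves differences of S and of the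
    numerator, and eta0 itself is bounded by K. *)
Lemma eta0_modulus j t theta t' theta' (e k : R) : 0 < e -> 0 < k ->
  `|t - t'| + A * `|theta - theta'| <= e -> k <= surv s t' theta' ->
  `|eta0 s t theta ord0 j - eta0 s t' theta' ord0 j| <= 2 * K * c * e / k.
Proof.
move=> e0 k0 te kS; rewrite ler_pdivlMr// mulrC.
set x := eta0 _ _ _ _ _; set y := eta0 _ _ _ _ _.
apply: (@le_trans _ _ `|surv s t' theta' * (x - y)|).
  by rewrite normrM ler_wpM2r// (le_trans kS)// ler_norm.
have -> : surv s t' theta' * (x - y) =
    (risk_cov j t theta - risk_cov j t' theta') - (surv s t theta - surv s t' theta') * x.
  by rewrite -!surv_eta0 -/x -/y; ring.
rewrite (le_trans (ler_normB _ _))// (_ : 2 * K * c * e = K * (c * e) + c * e * K);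
  last by ring.
rewrite lerD ?risk_cov_modulus// normrM ler_pM ?surv_modulus//.
exact: norm_eta0_le.
Qed.

Lemma measurable_surv theta : measurable_fun setT (fun t => surv s t theta).
Proof.
apply: continuous_measurable_fun; apply: (modulus_continuous c0) => t t' e e0 te.
by apply: surv_modulus => //; rewrite subrr normr0 mulr0 addr0.
Qed.

Lemma measurable_eta0 theta j :
  measurable_fun setT (fun t => eta0 s t theta ord0 j).
Proof.
rewrite (_ : (fun t => _) = fun t => surv s t theta `^ (-1) * risk_cov j t theta); last first.
  by apply/funext => t; rewrite eta0E powR_inv1// surv_ge0.
apply: measurable_funM.
  apply: (@measurableT_comp _ _ _ _ _ _ (fun x : R => x `^ (-1))).
    exact: measurable_powR.
  exact: measurable_surv.
apply: continuous_measurable_fun.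
have Kc : 0 < K * c by rewrite mulr_gt0.
apply: (modulus_continuous Kc) => t t' e e0 te.
rewrite -mulrA; apply: risk_cov_modulus => //.
by rewrite subrr normr0 mulr0 addr0.
Qed.

Let mX : forall i, measurable_fun setT (obs_full s i).
Proof. by have [mX _ _] := iX. Qed.

(** S is nonincreasing, so S < k forces the residual to be at least the infimum
    of the levels where S < k, and S is at most k there by continuity.  That
    infimum is finite unless k >= 1, since S tends to 1 at minus infinity. *)
Lemma low_surv theta (k : R) : 0 < k ->
  (P [set w | (surv s (resid s theta 0%N w) theta < k)%R] <= k%:E)%E.
Proof.
move=> k0; set E := mkset _.
have mE : measurable E.
  apply: measurable_set_bool; apply: measurable_fun_ltr; last exact: measurable_cst.
  exact: (measurableT_comp (measurable_surv theta) (measurable_resid s theta 0%N)).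
pose B := [set t : R | surv s t theta < k].
have [k1|k1] := leP 1 k.
  by rewrite (le_trans (probability_le1 P mE)).
have [B0|nB] := pselect (exists t, B t); last first.
  rewrite (_ : E = set0) ?measure0 ?lee_fin ?ltW//.
  by apply/seteqP; split=> // w Ew; case: nB; exists (resid s theta 0%N w).
have survP t : P [set w | at_risk s t theta 0%N w] = (surv s t theta)%:E.
  by rewrite /surv fine_probE//; apply: measurable_set_bool; exact: measurable_at_risk.
have lbB : has_lbound B.
  have k1' : 0 < 1 - k by rewrite subr_gt0.
  have [L L0 PL] := tight P (measurable_resid s theta 0%N) k1'.
  exists (- L) => t Bt; rewrite leNgt; apply/negP => tL.
  suff : k <= surv s t theta by rewrite leNgt Bt.
  have mL : measurable [set w | L <= `|resid s theta 0%N w|].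
    apply: measurable_set_bool; apply: measurable_fun_ler; first exact: measurable_cst.
    exact: (measurableT_comp (@normr_measurable R setT) (measurable_resid s theta 0%N)).
  have mr : measurable [set w | at_risk s t theta 0%N w].
    by apply: measurable_set_bool; exact: measurable_at_risk.
  have sub : ~` [set w | L <= `|resid s theta 0%N w|] `<=`
      [set w | at_risk s t theta 0%N w].
    move=> w /= /negP; rewrite -ltNge ltr_norml => /andP[rL _].
    by rewrite /at_risk ltW// (lt_trans tL).
  have : (P (~` [set w | (L <= `|resid s theta 0%N w|)%R]) <=
          P [set w | at_risk s t theta 0%N w])%E.
    by apply: le_measure sub; rewrite inE//; exact: measurableC.
  rewrite probability_setC// survP -(fine_probE P mL) -EFinB lee_fin.
  by move: PL; rewrite -(fine_probE P mL) lee_fin; lra.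
have infB : has_inf B by split.
apply: (@le_trans _ _ (surv s (inf B) theta)%:E).
  rewrite -survP; apply: le_measure; rewrite ?inE//.
    by apply: measurable_set_bool; exact: measurable_at_risk.
  by move=> w Ew; rewrite /at_risk /=; apply: ge_inf.
rewrite lee_fin; apply/ler_addgt0Pl => e e0.
have ec : 0 < e / c by rewrite divr_gt0.
have [t Bt tB] := inf_adherent ec infB.
have := @surv_modulus (inf B) theta t theta (e / c) ec.
rewrite subrr normr0 mulr0 addr0.
have -> : c * (e / c) = e by rewrite mulrCA divff ?mulr1// gt_eqF.
have iBt : inf B <= t by exact: ge_inf.
rewrite distrC ger0_norm ?subr_ge0// => /(_ _)/(le_trans (ler_norm _)) H.
have {}Bt : surv s t theta < k by [].
have : surv s (inf B) theta - surv s t theta <= e by apply: H; lra.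
lra.
Qed.

Lemma pmean_obs_core (h : rec -> R) :
  pmean P (obs_full s) (fun x => h (obs_core x)) = \int[P]_w h (obsX s 0%N w).
Proof. by []. Qed.

Lemma pmean_obs_Omega (h : rec -> R) : bounded_mfun h ->
  pmean P (obs_full s) (fun x => obs_Omega x * h (obs_core x)) = \int[P]_w h (obsX s 0%N w).
Proof.
by move=> bh; rewrite -condO//; apply: eq_Rintegral => w _; rewrite obs_OmegaE.
Qed.

Lemma pmean_obs_W (h : rec -> R) : bounded_mfun h ->
  pmean P (obs_full s) (fun x => obs_W x * h (obs_core x)) = \int[P]_w h (obsX s 0%N w).
Proof.
by move=> bh; rewrite -condW//; apply: eq_Rintegral => w _; rewrite obs_WE.
Qed.

Variable Theta : set vec.
Hypothesis cTheta : compact Theta.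

(** The net is scaled so that r bounds the displacement of the residuals. *)
Lemma Theta_net (r : R) : 0 < r -> exists net : seq vec,
  (forall th, th \in net -> Theta th) /\
  forall th, Theta th -> exists2 th', th' \in net & A * `|th - th'| <= r.
Proof.
move=> r0; have rA : 0 < r / (A + 1) by rewrite divr_gt0// ltr_wpDl.
have [net [nT cov]] := compact_net cTheta rA; exists net; split=> // th /cov[th' nth'].
rewrite ler_pdivlMr ?ltr_wpDl// => H; exists th' => //.
by rewrite (le_trans _ H)// mulrC ler_wpM2l// lerDl.
Qed.

(** Outside the unlikely event |Y| >= L all residuals stay below L' in absolute
    value, so t may be truncated to the compact interval [-L', L'] without
    changing any indicator.  A finite net of pairs (t, theta) then approximates
    every indicator except when the residual is close to the threshold of the
    net, which has small probability. *)
Lemma ulln_risk (m : obs -> R) : bounded_mfun m ->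
  ulln P (obs_full s) [set h | exists t theta, Theta theta /\
    h = fun x => m x * core_risk t theta (obs_core x)].
Proof.
move=> bm; have [_ [M M0 mM]] := bounded_mfunP bm.
have bmr t theta : bounded_mfun (fun x => m x * core_risk t theta (obs_core x)).
  by apply: bounded_mfunM => //; apply: bounded_core; exact: bounded_core_risk.
apply: ulln_approx => // [_ [t [theta [_ ->]]]|e e0]; first exact: bmr.
have e1 : 0 < e / (2 * M) by rewrite divr_gt0// mulr_gt0.
have mY : measurable_fun setT (obsY s 0%N) by exact: measurable_minr.
have [L L0 PL] := tight P mY e1.
have [N [_ TN]] := compact_bounded cTheta.
pose N1 := `|N| + 1; have TN1 th : Theta th -> `|th| <= N1.
  by apply: TN; rewrite /N1 ltr_pwDr// ler_norm.
have N10 : 0 <= N1 by rewrite addr_ge0.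
pose L' := L + (d1 + d2)%:R * (N1 * K).
have L'0 : 0 <= L' by rewrite addr_ge0 ?(ltW L0)// !mulr_ge0// ltW.
(* So that M (e / (2 M) + c (2 r)) = e: tail and near-threshold events get half
   of e each. *)
pose r := e / (4 * M * c).
have r0 : 0 < r by rewrite divr_gt0// !mulr_gt0.
have [nT [nTT covT]] := Theta_net r0.
have [nt [_ covt]] := compact_net (@segment_compact R (- L') L') r0.
pose far (y : rec) : R := (L <= `|y.1.1|)%R%:R.
have bfar : bounded_mfun far.
  apply: bounded_mfun_bool; apply: measurable_fun_ler; first exact: measurable_cst.
  apply: (measurableT_comp (@normr_measurable R setT)).
  by apply: (measurableT_comp measurable_fst); exact: measurable_fst.
pose near (q : R * vec) (y : rec) : R := (`|core_resid q.2 y - q.1| <= 2 * r)%R%:R.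
have bnear q : bounded_mfun (near q).
  by apply: bounded_mfun_bool; exact: measurable_near.
pose b q (x : obs) := M * (far (obs_core x) + near q (obs_core x)).
have bb q : bounded_mfun (b q).
  by apply: bounded_mfunZ; apply: (bounded_core (h := fun y => far y + near q y));
    exact: bounded_mfunD.
pose net := [seq (t, th) | t <- nt, th <- nT].
exists [set h | exists2 q, q \in net & [set fun x => m x * core_risk q.1 q.2 (obs_core x)] h].
exists [set h | exists2 q, q \in net & [set b q] h]; split.
- by apply: ulln_bigU => q; exact: ulln_bounded.
- by apply: ulln_bigU => q; exact: ulln_bounded.
- move=> _ [q _ ->]; rewrite /b pmeanZ//; last first.
    by apply: (bounded_core (h := fun y => far y + near q y)); exact: bounded_mfunD.
  rewrite (pmean_obs_core (fun y => far y + near q y)).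
  rewrite expectD; [|exact: bounded_obsX|exact: bounded_obsX].
  have r20 : 0 < 2 * r by rewrite mulr_gt0.
  have := expect_near q.2 q.1 r20.
  have : \int[P]_w far (obsX s 0%N w) <= e / (2 * M).
    have mfar : measurable_fun setT (fun w => L <= `|obsY s 0%N w|).
      apply: measurable_fun_ler; first exact: measurable_cst.
      exact: (measurableT_comp (@normr_measurable R setT) mY).
    by rewrite expect_bool// -lee_fin fine_probE//; exact: measurable_set_bool.
  move=> h1 h2; rewrite [leRHS](_ : e = M * (e / (2 * M) + c * (2 * r))).
    by rewrite ler_pM2l// lerD.
  by rewrite /r; field; rewrite !gt_eqF.
move=> _ [t [theta [Tth ->]]].
have ct : clip L' t \in `[- L', L'] by rewrite in_itv/= -ler_norml norm_clip.
have [t' t'n tt'] := covt _ ct; have [th' th'n thh'] := covT _ Tth.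
exists (fun x => m x * core_risk t' th' (obs_core x)), (b (t', th')).
have qn : (t', th') \in net by apply: allpairs_f.
split; [by exists (t', th')|by exists (t', th')|move=> i w].
rewrite -mulrBr normrM ler_pM// /core_risk /near /far !core_residE /=.
set r1 := resid s theta i w; set r2 := resid s th' i w.
have far0 : 0 <= (L <= `|obsY s i w|)%R%:R :> R by [].
have [LY|LY] := leP L `|obsY s i w|.
  rewrite (@le_trans _ _ 1)// ?lerDl//.
  by case: (t <= r1); case: (t' <= r2);
    rewrite ?subrr ?subr0 ?sub0r ?normrN ?normr1 ?normr0.
rewrite add0r; have r1L : `|r1| < L'.
  rewrite /r1 /resid (le_lt_trans (ler_normB _ _))// ltr_leD//.
  rewrite (le_trans (norm_dotp_le _ _))// ler_wpM2l// ler_pM//; first exact: TN1.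
have -> : (t <= r1) = (clip L' t <= r1).
  move: r1L; rewrite ltr_norml => /andP[r1a r1b].
  by rewrite /clip ge_max ge_min (ltW r1a) (leNgt L') r1b/= orbF.
rewrite distrC; apply: risk_diff; rewrite mulr_natl mulr2n lerD//.
  by rewrite distrC.
by rewrite (le_trans (resid_diff _ _ _ _))// distrC.
Qed.

Lemma bounded_surv theta : bounded_mfun (fun y : rec => surv s (core_resid theta y) theta).
Proof.
split; first exact: (measurableT_comp (measurable_surv theta) (measurable_core_resid theta)).
by exists 1 => y; rewrite ger0_norm ?surv_ge0// surv_le1.
Qed.

Lemma bounded_eta0 theta j :
  bounded_mfun (fun y : rec => eta0 s (core_resid theta y) theta ord0 j).
Proof.
split; first exact: (measurableT_comp (measurable_eta0 theta j) (measurable_core_resid theta)).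
by exists K => y; exact: norm_eta0_le.
Qed.

Lemma ulln_surv (m : obs -> R) : bounded_mfun m -> ulln P (obs_full s)
  [set h | exists2 theta, Theta theta &
    h = fun x => m x * surv s (core_resid theta (obs_core x)) theta].
Proof.
move=> bm; have [_ [M M0 mM]] := bounded_mfunP bm.
have bms theta : bounded_mfun (fun x => m x * surv s (core_resid theta (obs_core x)) theta).
  apply: bounded_mfunM => //; apply: bounded_core (bounded_surv theta).
apply: ulln_approx => // [_ [theta _ ->]|e e0]; first exact: bms.
pose r := e / (2 * M * c); have r0 : 0 < r by rewrite divr_gt0// !mulr_gt0.
have [nT [nTT covT]] := Theta_net r0.
exists [set h | exists2 th, th \in nT &
  [set fun x => m x * surv s (core_resid th (obs_core x)) th] h].
exists [set cst e]; split.
- by apply: ulln_bigU => th; exact: ulln_bounded.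
- exact: ulln_cst.
- by move=> _ ->; rewrite pmean_cst.
move=> _ [theta Tth ->]; have [th' th'n thh'] := covT _ Tth.
exists (fun x => m x * surv s (core_resid th' (obs_core x)) th'), (cst e).
split; [by exists th'|by []|move=> i w].
rewrite -mulrBr normrM /= [leRHS](_ : e = M * (c * (2 * r))); last first.
  by rewrite /r; field; rewrite !gt_eqF.
rewrite ler_pM//; apply: surv_modulus; first by rewrite mulr_gt0.
by rewrite mulr_natl mulr2n lerD// !core_residE (le_trans (resid_diff _ _ _ _)).
Qed.

Section weight.
Variables (rho0 : R -> vec -> R) (Kr : R).
Hypothesis Kr0 : 0 < Kr.
Hypothesis rho0K : forall t theta, Theta theta -> `|rho0 t theta| <= Kr.
Hypothesis ulln_rho0 : forall m : obs -> R, bounded_mfun m ->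
  ulln P (obs_full s) [set h | exists2 theta, Theta theta &
    h = fun x => m x * rho0 (core_resid theta (obs_core x)) theta].

Hypothesis bounded_rho0 : forall theta, Theta theta ->
  bounded_mfun (fun y : rec => rho0 (core_resid theta y) theta).

(** The factor of the score that the small-ball bounds control; the weight rho0
    is kept apart because nothing but a uniform law is known of it. *)
Definition score_core theta j (y : rec) : R :=
  core_uncens y * (core_cov j y - eta0 s (core_resid theta y) theta ord0 j).

Definition score theta j (x : obs) : R :=
  obs_Omega x * score_core theta j (obs_core x) * rho0 (core_resid theta (obs_core x)) theta.

Lemma bounded_score_core theta j : bounded_mfun (score_core theta j).
Proof.
apply: bounded_mfunM bounded_core_uncens _.
by apply: bounded_mfunB; [exact: bounded_core_cov|exact: bounded_eta0].
Qed.

Lemma bounded_score theta j : Theta theta -> bounded_mfun (score theta j).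
Proof.
move=> Tth; apply: bounded_mfunM; last exact: (bounded_core (bounded_rho0 Tth)).
apply: bounded_mfunM bounded_obs_Omega _; exact: (bounded_core (bounded_score_core theta j)).
Qed.

Lemma norm_core_uncens_le y : `|core_uncens y| <= 1.
Proof. by rewrite /core_uncens; case: (y.1.2); rewrite ?normr1 ?normr0. Qed.

(** The factor Z - eta0 is replaced by its value at the nearest point of a finite
    net of Theta, leaving finitely many fixed multipliers of the class of rho0.
    The replacement costs at most a where S >= k at the point of the net, and at
    most 2 K on the event S < k, whose probability is at most k. *)
Lemma ulln_score j : ulln P (obs_full s)
  [set h | exists2 theta, Theta theta & h = score theta j].
Proof.
apply: ulln_approx => // [_ [theta Tth ->]|e e0]; first exact: bounded_score.
(* Solves K Kr (a + 2 K k) = e with equal shares; r makes [eta0_modulus] give a. *)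
pose k := e / (4 * K * K * Kr); have k0 : 0 < k by rewrite divr_gt0// !mulr_gt0.
pose a := e / (2 * K * Kr); have a0 : 0 < a by rewrite divr_gt0// !mulr_gt0.
pose r := a * k / (4 * K * c); have r0 : 0 < r.
  by apply: divr_gt0; [exact: mulr_gt0|rewrite !mulr_gt0].
have [nT [nTT covT]] := Theta_net r0.
pose low th (y : rec) : R := (surv s (core_resid th y) th < k)%R%:R.
have mlow th : measurable_fun setT (fun y => surv s (core_resid th y) th < k).
  by apply: measurable_fun_ltr; [exact: (bounded_surv th).1|exact: measurable_cst].
have blow th : bounded_mfun (low th) by exact: bounded_mfun_bool.
pose B th (x : obs) := K * Kr * (a + 2 * K * low th (obs_core x)).
have blowc th : bounded_mfun (fun x => low th (obs_core x)) by exact: (bounded_core (blow th)).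
have bB th : bounded_mfun (B th).
  apply: bounded_mfunZ; apply: bounded_mfunD; first exact: bounded_mfun_cst.
  exact: bounded_mfunZ.
exists [set h | exists2 th, th \in nT & [set h | exists2 theta, Theta theta &
  h = fun x => (obs_Omega x * score_core th j (obs_core x)) *
               rho0 (core_resid theta (obs_core x)) theta] h].
exists [set h | exists2 th, th \in nT & [set B th] h]; split.
- apply: ulln_bigU => th; apply: ulln_rho0; apply: bounded_mfunM bounded_obs_Omega _.
  exact: (bounded_core (bounded_score_core th j)).
- by apply: ulln_bigU => th; exact: ulln_bounded.
- move=> _ [th _ ->]; rewrite /B pmeanZ//; last first.
    by apply: bounded_mfunD; [exact: bounded_mfun_cst|exact: bounded_mfunZ].
  rewrite pmeanD//; [|exact: bounded_mfun_cst|exact: bounded_mfunZ].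
  rewrite pmean_cst pmeanZ//.
  have : pmean P (obs_full s) (fun x => low th (obs_core x)) <= k.
    rewrite pmean_obs_core /low expect_bool; last first.
      exact: (measurableT_comp (mlow th) measurable_obsX).
    rewrite -lee_fin fine_probE; first exact: low_surv.
    by apply: measurable_set_bool; exact: (measurableT_comp (mlow th) measurable_obsX).
  move=> h1; rewrite [leRHS](_ : e = K * Kr * (a + 2 * K * k)).
    apply: ler_wpM2l; first by rewrite mulr_ge0// ltW.
    by rewrite lerD2l ler_wpM2l// mulr_ge0// ltW.
  by rewrite /a /k; field; rewrite !gt_eqF.
move=> _ [theta Tth ->]; have [th' th'n thh'] := covT _ Tth.
exists (fun x => obs_Omega x * score_core th' j (obs_core x) *
                 rho0 (core_resid theta (obs_core x)) theta), (B th').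
split; [by exists th' => //; exists theta|by exists th'|move=> i w].
rewrite /score -mulrBl -mulrBr !normrM /B /score_core -mulrBr.
set x := obs_full s i w; set u := resid s theta i w; set u' := resid s th' i w.
rewrite opprB addrC addrA subrK addrC normrM.
rewrite mulrAC ler_pM//.
  by apply: ler_pM => //; [rewrite norm_clip// ltW|exact: rho0K].
rewrite -[leRHS]mul1r ler_pM ?norm_core_uncens_le//.
rewrite /low !core_residE -/u -/u' [- _ + _]addrC.
have [lo|hi] := ltP (surv s u' th') k.
  rewrite mulr1 (le_trans (ler_normB _ _))//.
  have := norm_eta0_le u theta j; have := norm_eta0_le u' th' j.
  by move=> h1 h2; rewrite ler_wpDl ?(ltW a0)//; lra.
rewrite mulr0 addr0 distrC.
have r20 : 0 < 2 * r by rewrite mulr_gt0.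
have := @eta0_modulus j u theta u' th' (2 * r) k r20 k0.
have -> : 2 * K * c * (2 * r) / k = a by rewrite /r; field; rewrite !gt_eqF.
apply => //; rewrite mulr_natl mulr2n lerD//.
by rewrite (le_trans (resid_diff _ _ _ _)).
Qed.

Lemma Psi_n_score n w theta j :
  (Psi_n s n w (eta0 s) rho0 theta) ord0 j = smean (obs_full s) (score theta j) n w.
Proof.
rewrite /Psi_n /smean !mxE; congr (_ * _); rewrite summxE; apply: eq_bigr => i _.
rewrite !mxE /score /score_core obs_OmegaE core_covE !core_residE.
by rewrite /core_uncens /obs_core /eta0 /= !mxE; ring.
Qed.

(** This is where Omega averages out: given the full data its mean is 1. *)
Lemma Psi_score theta j : Theta theta ->
  (Psi s (eta0 s) rho0 theta) ord0 j = pmean P (obs_full s) (score theta j).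
Proof.
move=> Tth; rewrite mxE.
have bphi : bounded_mfun (fun y : rec =>
    score_core theta j y * rho0 (core_resid theta y) theta).
  by apply: bounded_mfunM; [exact: bounded_score_core|exact: bounded_rho0].
have := pmean_obs_Omega bphi; rewrite /score.
under eq_fun do rewrite mulrA.
move=> ->; apply: eq_Rintegral => w _.
by rewrite /score_core (core_covE j 0%N w) (core_residE theta 0%N w) /core_uncens /=; ring.
Qed.

Lemma uniform_Psi (e : R) : 0 < e -> vanishing P
  (fun n => [set w | exists2 theta, Theta theta &
    e < `|Psi_n s n w (eta0 s) rho0 theta - Psi s (eta0 s) rho0 theta|]).
Proof.
move=> e0; apply: vanishing_sub (vanishing_bigU (index_enum 'I_(d1 + d2))
  (fun j => (ulln_score j).2 e e0)) _; exists 0%N => n _ w [theta Tth].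
move=> /(norm_rV_gt (ltW e0))[j]; rewrite rV_subE.
rewrite Psi_n_score Psi_score// => ej; exists j; first exact: mem_index_enum.
by exists (score theta j) => //; exists theta.
Qed.

End weight.

(** The criterion depends on the plug-in functions only through the products
    rho (Z - eta), averaged with weights bounded by K. *)
Lemma Psi_n_close n w theta (eta eta' : R -> vec -> vec) (rho rho' : R -> vec -> R)
    (b : R) : 0 <= b ->
  (forall i j, let r := resid s theta i w in
    `|rho r theta * (covz s i w ord0 j - eta r theta ord0 j)
      - rho' r theta * (covz s i w ord0 j - eta' r theta ord0 j)| <= b) ->
  `|Psi_n s n w eta rho theta - Psi_n s n w eta' rho' theta| <= K * b.
Proof.
move=> b0 close; have Kb0 : 0 <= K * b by rewrite mulr_ge0// ltW.
apply: norm_rV_le => // j; rewrite rV_subE.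
pose term (et : R -> vec -> vec) (rh : R -> vec -> R) i :=
  wOmega s i w * (obsD s i w)%:R * (rh (resid s theta i w) theta *
  (covz s i w ord0 j - et (resid s theta i w) theta ord0 j)).
have PsiE et rh : (Psi_n s n w et rh theta) ord0 j =
    n%:R^-1 * \sum_(i < n) term et rh i.
  rewrite /Psi_n [LHS]mxE; congr (_ * _); rewrite summxE; apply: eq_bigr => i _.
  by rewrite [LHS]mxE rV_subE /term; ring.
rewrite !PsiE -mulrBr -sumrB.
apply: (@norm_average_le R n (fun i => term eta rho i - term eta' rho' i)) => // i.
rewrite /term -mulrBr normrM ler_pM//.
rewrite normrM -[leRHS]mulr1 ler_pM ?OK//.
by case: obsD; rewrite ?normr1 ?normr0.
Qed.

(** In the product rho_hat (Z - eta_hat) = (D Z - N) / W the denominator D of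
    eta_hat cancels.  The weights may be negative, so D can vanish although N
    does not; the convention for 0/0 then makes the left-hand product 0, but
    D = 0 also forces S <= e, and the limit S Z - E[1(eps >= t) Z] is at most
    2 K S in absolute value. *)
Lemma hat_close n w theta t (z : R) j (e : R) :
  let D := n%:R^-1 * \sum_(i < n) wW s i w * (at_risk s t theta i w)%:R in
  let N := n%:R^-1 * \sum_(i < n)
             wW s i w * (at_risk s t theta i w)%:R * covz s i w ord0 j in
  let W := n%:R^-1 * \sum_(i < n) wW s i w in
  (0 < n)%N -> `|z| <= K -> 0 <= e -> e <= 2^-1 ->
  `|D - surv s t theta| <= e -> `|N - risk_cov j t theta| <= e -> `|W - 1| <= e ->
  `|rho_hat s n w t theta * (z - eta_hat s n w t theta ord0 j)
    - surv s t theta * (z - eta0 s t theta ord0 j)| <= (6 * K + 2) * e.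
Proof.
move=> D N W n0 zK e0 e2 De Ne We.
have n0' : n%:R^-1 != 0 :> R by rewrite invr_neq0// pnatr_eq0 -lt0n.
have W2 : 2^-1 <= W by move: We; rewrite ler_norml => /andP[]; lra.
have W0 : 0 < W by rewrite (lt_le_trans _ W2).
have rhoE : rho_hat s n w t theta = D / W.
  by rewrite /rho_hat /D /W invfM mulrACA divff// mul1r.
have etaE : eta_hat s n w t theta ord0 j = D^-1 * N.
  rewrite /eta_hat !mxE summxE /D /N invfM mulrACA mulVf ?mul1r//.
  by congr (_ * _); apply: eq_bigr => i _; rewrite !mxE.
rewrite rhoE etaE; set S := surv s t theta in De *; set Z := risk_cov j t theta in Ne.
have -> : S * (z - eta0 s t theta ord0 j) = S * z - Z.
  by rewrite mulrBr surv_eta0.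
have ZS : `|Z| <= K * S by exact: norm_risk_cov_le.
have S0 : 0 <= S by exact: surv_ge0.
have S1 : S <= 1 by exact: surv_le1.
have SzZ : `|S * z - Z| <= 2 * K * S.
  rewrite (le_trans (ler_normB _ _))// (_ : 2 * K * S = S * K + K * S); last by ring.
  by rewrite lerD// normrM ger0_norm// ler_wpM2l.
have [D0|D0] := eqVneq D 0.
  rewrite D0 !mul0r sub0r normrN (le_trans SzZ)//.
  move: De; rewrite D0 sub0r normrN ger0_norm// => Se.
  rewrite (@le_trans _ _ (2 * K * e))//.
    by rewrite ler_wpM2l// mulr_ge0// ltW.
  by rewrite ler_wpM2r//; have := ltW K0; lra.
have -> : D / W * (z - D^-1 * N) - (S * z - Z) =
    ((D - S) * z - (N - Z) - (S * z - Z) * (W - 1)) / W.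
  by field; rewrite D0 gt_eqF.
rewrite normrM normfV (gtr0_norm W0) ler_pdivrMr//.
apply: (@le_trans _ _ ((3 * K + 1) * e)); last first.
  rewrite -mulrA (_ : 6 * K + 2 = (3 * K + 1) * 2); last by ring.
  rewrite -[leRHS]mulrA ler_wpM2l//; first by have := ltW K0; lra.
  by rewrite mulrA mulrAC ler_peMl//; lra.
rewrite (le_trans (ler_normB _ _))// (_ : (3 * K + 1) * e = (e * K + e) + 2 * K * e);
  last by ring.
apply: lerD.
  by rewrite (le_trans (ler_normB _ _))// lerD// normrM ler_pM.
rewrite normrM ler_pM// (le_trans SzZ)//.
by rewrite -[leRHS]mulr1 ler_wpM2l// mulr_ge0// ltW.
Qed.

Lemma hat_vanishing (e : R) : 0 < e -> vanishing P
  (fun n => [set w | exists2 theta, Theta theta &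
    e < `|Psi_n s n w (eta_hat s n w) (rho_hat s n w) theta
          - Psi_n s n w (eta0 s) (surv s) theta|]).
Proof.
move=> e0; pose u := Num.min 2^-1 (e / (K * (6 * K + 2))).
have C0 : 0 < K * (6 * K + 2) by rewrite mulr_gt0// addr_gt0// mulr_gt0.
have u0 : 0 < u by rewrite lt_min invr_gt0 ltr0n divr_gt0.
have bWz j : bounded_mfun (fun x => obs_W x * core_cov j (obs_core x)).
  by apply: bounded_mfunM bounded_obs_W (bounded_core (bounded_core_cov j)).
have vD := (ulln_risk bounded_obs_W).2 _ u0.
have vN := vanishing_bigU (index_enum 'I_(d1 + d2))
  (fun j => (ulln_risk (bWz j)).2 _ u0).
have vW := (ulln_bounded iX bounded_obs_W).2 _ u0.
apply: vanishing_sub (vanishingU vD (vanishingU vN vW)) _.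
exists 1%N => n n0 w [theta Tth lt].
apply: contrapT => /not_orP[nD /not_orP[nN nW]].
move: lt; rewrite ltNge => /negP; apply.
have DE t : smean (obs_full s) (fun x => obs_W x * core_risk t theta (obs_core x)) n w =
    n%:R^-1 * \sum_(i < n) wW s i w * (at_risk s t theta i w)%:R.
  by congr (_ * _); apply: eq_bigr => i _; rewrite obs_WE.
have ND j t : smean (obs_full s)
     (fun x => obs_W x * core_cov j (obs_core x) * core_risk t theta (obs_core x)) n w =
    n%:R^-1 * \sum_(i < n) wW s i w * (at_risk s t theta i w)%:R * covz s i w ord0 j.
  by congr (_ * _); apply: eq_bigr => i _; rewrite obs_WE core_covE mulrAC.
have WE : smean (obs_full s) obs_W n w = n%:R^-1 * \sum_(i < n) wW s i w.
  by congr (_ * _); apply: eq_bigr => i _; rewrite obs_WE.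
have pD t : pmean P (obs_full s) (fun x => obs_W x * core_risk t theta (obs_core x)) =
    surv s t theta.
  by rewrite pmean_obs_W ?survE//; exact: bounded_core_risk.
have pN j t : pmean P (obs_full s)
    (fun x => obs_W x * core_cov j (obs_core x) * core_risk t theta (obs_core x)) =
    risk_cov j t theta.
  have := pmean_obs_W (bounded_mfunM (bounded_core_cov j) (bounded_core_risk t theta)).
  under eq_fun do rewrite mulrA.
  move=> ->; apply: eq_Rintegral => w' _.
  by rewrite (core_covE j 0%N w') mulrC.
have pW : pmean P (obs_full s) obs_W = 1.
  have := pmean_obs_W (bounded_mfun_cst _ 1).
  under eq_fun do rewrite /= mulr1.
  by rewrite expect_cst.
have b0 : 0 <= (6 * K + 2) * u.
  by rewrite mulr_ge0 ?(ltW u0)// addr_ge0// mulr_ge0// ltW.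
apply: (@le_trans _ _ (K * ((6 * K + 2) * u))); last first.
  rewrite mulrA -ler_pdivlMl// mulrC /u ge_min; apply/orP; right.
  by [].
apply: Psi_n_close; first exact: b0.
move=> i j; cbv zeta; set r := resid s theta i w.
apply: hat_close => //.
- by rewrite (le_trans (coord_le_norm _ _))// ZK.
- exact: ltW.
- by rewrite /u ge_min lexx.
- rewrite -DE -(pD r) leNgt; apply/negP => h; apply: nD.
  by exists (fun x => obs_W x * core_risk r theta (obs_core x)) => //; exists r, theta.
- rewrite -ND -(pN j r) leNgt; apply/negP => h; apply: nN.
  exists j; first exact: mem_index_enum.
  exists (fun x => obs_W x * core_cov j (obs_core x) * core_risk r theta (obs_core x)) => //.
  by exists r, theta.
- by rewrite -WE -pW leNgt; apply/negP => h; apply: nW; exists obs_W.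
Qed.

(** With rho0 = S the integrand is S Z - E[1(eps >= t) Z], free of any quotient
    and Lipschitz in theta. *)
Lemma Psi_surv_continuous : continuous (Psi s (eta0 s) (surv s)).
Proof.
move=> theta; have FF : Filter (nbhs theta) by exact: nbhs_filter.
apply/cvgrPdist_le => e e0.
pose r := e / (4 * K * c * (A + 1)).
have A1 : 0 < A + 1 by rewrite ltr_wpDl.
have r0 : 0 < r by rewrite divr_gt0// !mulr_gt0.
near=> theta'.
have thr : `|theta - theta'| <= r.
  near: theta'; apply: filterS (nbhsx_ballx theta r r0) => y.
  by rewrite -ball_normE /= => /ltW.
have q0 : 0 < 2 * ((A + 1) * r) by rewrite mulr_gt0// mulr_gt0.
have Aq : A * `|theta - theta'| <= (A + 1) * r.
  by rewrite ler_pM// lerDl.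
apply: norm_rV_le => [|j]; first exact: ltW.
rewrite rV_subE.
pose f th (y : rec) := core_uncens y *
  (surv s (core_resid th y) th * core_cov j y - risk_cov j (core_resid th y) th).
have fE th : Psi s (eta0 s) (surv s) th ord0 j = \int[P]_w f th (obsX s 0%N w).
  rewrite [LHS]mxE; apply: eq_Rintegral => w _.
  by rewrite /f (core_covE j 0%N w) (core_residE th 0%N w) -surv_eta0 /core_uncens /=; ring.
have bf th : bounded_mfun (fun w => f th (obsX s 0%N w)).
  apply: (bounded_obsX (h := f th)).
  rewrite (_ : f th = fun y => core_uncens y * (surv s (core_resid th y) th *
      (core_cov j y - eta0 s (core_resid th y) th ord0 j))); last first.
    by apply/funext => y; rewrite /f -surv_eta0; ring.
  apply: bounded_mfunM bounded_core_uncens _; apply: bounded_mfunM (bounded_surv th) _.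
  by apply: bounded_mfunB; [exact: bounded_core_cov|exact: bounded_eta0].
have DE : Psi s (eta0 s) (surv s) theta ord0 j - Psi s (eta0 s) (surv s) theta' ord0 j
    = \int[P]_w (f theta (obsX s 0%N w) - f theta' (obsX s 0%N w)).
  rewrite (expectB P (bf theta) (bf theta')).
  congr (_ - _).
    exact: fE.
  exact: fE.
rewrite DE.
apply: norm_expect_le => [|w]; first exact: (bounded_mfunB (bf theta) (bf theta')).
set y := obsX s 0%N w.
have rr : `|core_resid theta y - core_resid theta' y| + A * `|theta - theta'| <= 2 * ((A + 1) * r).
  rewrite mulr_natl mulr2n lerD//.
  exact: (le_trans (resid_diff theta theta' 0%N w)).
have h1 := surv_modulus q0 rr; have h2 := risk_cov_modulus j q0 rr.
rewrite /f -mulrBr normrM (le_trans (ler_wpM2r _ (norm_core_uncens_le _)))// mul1r.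
set S := surv _ _ _ in h1 *; set S' := surv _ _ _ in h1 *.
set Z := risk_cov _ _ _ in h2 *; set Z' := risk_cov _ _ _ in h2 *.
have -> : S * core_cov j y - Z - (S' * core_cov j y - Z') =
    (S - S') * core_cov j y - (Z - Z') by ring.
rewrite (le_trans (ler_normB _ _))// [leRHS](_ : e = c * (2 * ((A + 1) * r)) * K
    + K * (c * (2 * ((A + 1) * r)))); last first.
  by rewrite /r; field; rewrite !gt_eqF.
by rewrite lerD// normrM ler_pM// norm_core_cov.
Unshelve. all: by end_near. Qed.

End criterion.

(** * Consistency *)

Lemma glivenko_cantelli_sub d (T : measurableType d) (R : realType)
    (P : probability T R) dS (S : measurableType dS) (V : T -> S)
    (F F' : set (S -> R)) :
  F' `<=` F -> glivenko_cantelli P V F -> glivenko_cantelli P V F'.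
Proof.
move=> F'F [mF gc]; split=> [f /F'F /mF//|d' T' P' X iX lX].
apply/cvg0_outerP => e e0.
have /cvg0_outerP/(_ e e0)/vanishing_sub := gc _ _ _ _ iX lX; apply.
exists 0%N => n _ w /= /lt_le_trans; apply; apply: ereal_sup_le.
by move=> _ [f Ff <-]; exists f => //; exact: F'F.
Qed.

Lemma supnorm_le (R : realType) p (V : normedZmodType R) (Theta : set 'rV[R]_p)
    (g : R -> 'rV[R]_p -> V) (b : R) t theta :
  Theta theta -> (supnorm Theta g <= b%:E)%E -> `|g t theta| <= b.
Proof.
move=> Tth gb; rewrite -lee_fin (le_trans _ gb)//.
by apply: ereal_sup_ubound; exists (t, theta).
Qed.

Lemma supnorm_lty (R : realType) p (V : normedZmodType R) (Theta : set 'rV[R]_p)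
    (g : R -> 'rV[R]_p -> V) : (supnorm Theta g < +oo)%E ->
  exists2 b : R, 0 < b & forall t theta, Theta theta -> `|g t theta| <= b.
Proof.
move=> gy; pose b := `|fine (supnorm Theta g)| + 1.
exists b => [|t theta Tth]; first by rewrite ltr_wpDl.
apply: (supnorm_le t Tth); rewrite /b.
case: (supnorm Theta g) gy => [r _| |_] //=; last by rewrite leNye.
by rewrite lee_fin (le_trans (ler_norm r))// lerDl.
Qed.

(** If theta_hat is at distance e or more from theta0 then |Phi| >= m there, so
    either the criterion is off its limit by m / 2 or it is itself above m / 4. *)
Lemma consistent_of_uniform d (T : measurableType d) (R : realType)
    (P : probability T R) p (Theta : set 'rV[R]_p) (theta0 : 'rV[R]_p)
    (Phi : 'rV[R]_p -> 'rV[R]_p) (Phi_n : nat -> T -> 'rV[R]_p -> 'rV[R]_p)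
    (theta_hat : nat -> T -> 'rV[R]_p) :
  compact Theta -> {within Theta, continuous Phi} ->
  (forall theta, Theta theta -> Phi theta = 0 -> theta = theta0) ->
  (forall n w, Theta (theta_hat n w)) ->
  (forall e : R, 0 < e -> vanishing P (fun n => [set w | exists2 theta,
     Theta theta & e < `|Phi_n n w theta - Phi theta|])) ->
  cvg0_outer P (fun n w => (`|Phi_n n w (theta_hat n w)|)%:E) ->
  cvg0_outer P (fun n w => (`|theta_hat n w - theta0|)%:E).
Proof.
move=> cT cPhi uniq hatT unif root; apply/cvg0_outerP => e e0.
have [m m0 mPhi] := unique_zero_separated cT cPhi uniq e0.
have m2 : 0 < m / 2 by rewrite divr_gt0.
have m4 : 0 < m / 4 by rewrite divr_gt0.
have /cvg0_outerP/(_ _ m4) vroot := root.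
apply: vanishing_sub (vanishingU (unif _ m2) vroot) _; exists 0%N => n _ w /=.
rewrite lte_fin => /ltW /(mPhi _ (hatT n w)) mle.
have [h|h] := ltP (m / 2) `|Phi_n n w (theta_hat n w) - Phi (theta_hat n w)|.
  by left; exists (theta_hat n w).
right; rewrite /= lte_fin.
have : `|Phi (theta_hat n w)| <= `|Phi_n n w (theta_hat n w)|
    + `|Phi_n n w (theta_hat n w) - Phi (theta_hat n w)|.
  rewrite (le_trans _ (ler_normB _ _))// opprB addrC subrK.
  by [].
by lra.
Qed.

Theorem theorem3p1 (R : realType) (d : measure_display) (T : measurableType d)
    (P : probability T R) (d1 d2 : nat) (s : aft_sample P d1 d2)
    (Theta : set 'rV[R]_(d1 + d2)) (theta0 : 'rV[R]_(d1 + d2))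
    (model : aft_model s theta0)
    (mar : missing_at_random s)
    (weights : weights_ok s)
    (cond1 : bounded_covariate s)
    (cond2 : regular_error_density s)
    (cond3 : bounded_censoring_density s)
    (condA : tail_condition s Theta)
    (condB : observation_condition s)
    (cTheta : compact Theta) :
  (forall rho0 : R -> 'rV[R]_(d1 + d2) -> R,
     unique_root s Theta rho0 theta0 ->
   forall (eta : nat -> T -> R -> 'rV[R]_(d1 + d2) -> 'rV[R]_(d1 + d2))
          (rho : nat -> T -> R -> 'rV[R]_(d1 + d2) -> R),
     plug_in s Theta rho0 eta rho ->
   cvg0_outer P (fun n w => ereal_sup
     [set (`|Psi_n s n w (eta n w) (rho n w) theta
             - Psi s (eta0 s) rho0 theta|)%:E | theta in Theta]) /\
   (* Without continuity of the limit criterion, consistency fails: a unique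
      root need not be separated from near-zeros elsewhere in Theta. *)
   ({within Theta, continuous (Psi s (eta0 s) rho0)} ->
    forall theta_hat : nat -> T -> 'rV[R]_(d1 + d2),
      (forall n w, Theta (theta_hat n w)) ->
      approximate_root s eta rho theta_hat ->
      consistent P theta_hat theta0)) /\
  (unique_root s Theta (surv s) theta0 ->
   forall theta_hat : nat -> T -> 'rV[R]_(d1 + d2),
     (forall n w, Theta (theta_hat n w)) ->
     approximate_root s (eta_hat s) (rho_hat s) theta_hat ->
     consistent P theta_hat theta0).
Proof.
have [_ _ _ iX] := model.
have [c c0 ball] := resid_small_ball model cond1 cond2 cond3.
have [[K1 wK1] wE] := weights; have [K2 zK2] := cond1.
pose K := `|K1| + `|K2| + 1.
have K0 : 0 < K by rewrite ltr_wpDl// addr_ge0.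
have K1K : K1 <= K by rewrite /K -addrA (le_trans (ler_norm _))// lerDl addr_ge0.
have K2K : K2 <= K.
  by rewrite /K addrAC (le_trans (ler_norm K2))// lerDr addr_ge0.
have OK i w : `|wOmega s i w| <= K by have [/le_trans + _] := wK1 i w; exact.
have WK i w : `|wW s i w| <= K by have [_ /le_trans] := wK1 i w; exact.
have ZK i w : `|covz s i w| <= K by exact: le_trans (zK2 i w) K2K.
have [mXW _ _] := iX; have mX := measurable_obsX iX.
have bO : bounded_mfun (wOmega s 0%N) by split => //; exists K.
have bW : bounded_mfun (wW s 0%N) by split => //; exists K.
have condO phi := @cond_exp1_mul _ _ _ P _ _ _ _ phi mX bO (wE 0%N).1.
have condW phi := @cond_exp1_mul _ _ _ P _ _ _ _ phi mX bW (wE 0%N).2.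
split; last first.
  move=> [T0 _ uniq] theta_hat hatT root.
  apply: (consistent_of_uniform cTheta _ uniq hatT _ root).
    apply: continuous_subspaceT.
    exact: (Psi_surv_continuous K0 c0 iX ZK ball).
  move=> e e0; have e2 : 0 < e / 2 by rewrite divr_gt0.
  have v1 := hat_vanishing K0 c0 iX OK WK ZK ball condW cTheta e2.
  have surv1 t theta : Theta theta -> `|surv s t theta| <= 1.
    by move=> _; rewrite ger0_norm ?surv_ge0// (surv_le1 iX).
  have v2 := uniform_Psi K0 c0 iX OK ZK ball condO cTheta ltr01 surv1
    (ulln_surv K0 c0 iX ZK ball cTheta) (fun th _ => bounded_surv c0 iX ZK ball th) e2.
  apply: vanishing_sub (vanishingU v1 v2) _; exists 0%N => n _ w [theta Tth lt].
  pose a := Psi_n s n w (eta_hat s n w) (rho_hat s n w) theta.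
  have {}lt : e < `|a - Psi s (eta0 s) (surv s) theta| := lt.
  pose b := Psi_n s n w (eta0 s) (surv s) theta.
  have [h|h] : e / 2 < `|a - b| \/ `|a - b| <= e / 2.
      by apply/orP; rewrite leNgt orbN.
    by left; exists theta; [exact: Tth|exact: h].
  right; exists theta; first exact: Tth.
  rewrite -/b.
  have := ler_distD b a (Psi s (eta0 s) (surv s) theta).
  by rewrite [e]splitr in lt; lra.
move=> rho0 [T0 _ uniq] eta rho [[delta [_ delta0 close]]].
move=> [_ _ _ [F [gcF Frho0]]] [_ _ _ /supnorm_lty[Kr Kr0 rho0K]].
pose V (y : R * bool * 'rV[R]_(d1 + d2)) := (y.1.1, y.2).
have mV : measurable_fun setT V.
  apply: measurable_fun_pair; last exact: measurable_snd.
  by apply: (measurableT_comp measurable_fst); exact: measurable_fst.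
pose F0 : set (R * 'rV[R]_(d1 + d2) -> R) := [set f | exists2 theta,
  Theta theta & f = fun v => rho0 (v.1 - dotp theta v.2) theta].
have gcF0 : glivenko_cantelli P (fun w => V (obs_core (obs_full s 0%N w))) F0.
  by apply: glivenko_cantelli_sub gcF => _ [theta Tth ->]; exact: Frho0.
have F0K f v : F0 f -> `|f v| <= Kr by move=> [theta Tth ->]; exact: rho0K.
have ulln_rho0 (m : _ -> R) : bounded_mfun m -> ulln P (obs_full s)
    [set h | exists2 theta, Theta theta &
      h = fun x => m x * rho0 (core_resid theta (obs_core x)) theta].
  move=> bm.
  have u := ulln_gc iX (measurableT_comp mV (@measurable_obs_core R d1 d2)) F0K gcF0 bm.
  apply: ulln_sub u _ => _ [theta Tth ->].
  by exists (fun v => rho0 (v.1 - dotp theta v.2) theta) => //; exists theta.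
have bounded_rho0 theta : Theta theta ->
    bounded_mfun (fun y : R * bool * 'rV[R]_(d1 + d2) => rho0 (core_resid theta y) theta).
  move=> Tth; split; last by exists Kr => y; exact: rho0K.
  have mf : measurable_fun setT
      (fun v : R * 'rV[R]_(d1 + d2) => rho0 (v.1 - dotp theta v.2) theta).
    by apply: (gcF0.1 _ _).1; exists theta.
  exact: (measurableT_comp mf mV).
have unif (e : R) : 0 < e -> vanishing P (fun n => [set w | exists2 theta, Theta theta &
    e < `|Psi_n s n w (eta n w) (rho n w) theta - Psi s (eta0 s) rho0 theta|]).
  move=> e0; have e2 : 0 < e / 2 by rewrite divr_gt0.
  have v2 := uniform_Psi K0 c0 iX OK ZK ball condO cTheta Kr0 rho0K ulln_rho0
    bounded_rho0 e2.
  (* |z - eta| <= 2 K + 1 and |rho0| <= Kr multiply the errors in rho and eta. *)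
  pose C := 2 * K + 1 + Kr.
  have C0 : 0 < C by rewrite !addr_gt0// mulr_gt0.
  pose u := Num.min 1 (e / 2 / (K * C)).
  have u0 : 0 < u by rewrite lt_min ltr01 divr_gt0// mulr_gt0.
  have /cvgrPdist_le/(_ _ u0)[N _ HN] := delta0.
  apply: vanishing_sub v2 _; exists N => n /HN /= dn w [theta Tth lt].
  exists theta => //; move: dn; rewrite sub0r normrN => /(le_trans (ler_norm _)) dn.
  have [etad rhod] := close n w.
  have du1 : delta n <= 1 by rewrite (le_trans dn)// ge_min lexx.
  have duC : delta n <= e / 2 / (K * C) by rewrite (le_trans dn)// ge_min lexx orbT.
  have d0 : 0 <= delta n by exact: le_trans (normr_ge0 _) (supnorm_le 0 Tth rhod).
  have Cd0 : 0 <= C * delta n by rewrite mulr_ge0// ltW.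
  have diff : `|Psi_n s n w (eta n w) (rho n w) theta
                - Psi_n s n w (eta0 s) rho0 theta| <= K * (C * delta n).
    apply: (Psi_n_close K0 OK) => // i j; cbv zeta; set r := resid s theta i w.
    set z := covz s i w ord0 j; set x := eta n w r theta ord0 j.
    set x0 := eta0 s r theta ord0 j.
    have zK : `|z| <= K by rewrite (le_trans (coord_le_norm _ _)).
    have x0K : `|x0| <= K by exact: (norm_eta0_le K0 iX ZK).
    have xx0 : `|x - x0| <= delta n.
      rewrite /x /x0 -rV_subE (le_trans (coord_le_norm _ _))//.
      exact: (supnorm_le r Tth etad).
    have rr0 : `|rho n w r theta - rho0 r theta| <= delta n.
      exact: (supnorm_le r Tth rhod).
    have -> : rho n w r theta * (z - x) - rho0 r theta * (z - x0) =
        (rho n w r theta - rho0 r theta) * (z - x) - rho0 r theta * (x - x0) by ring.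
    rewrite (le_trans (ler_normB _ _))// [leRHS]mulrDl; apply: lerD; last first.
      by rewrite normrM ler_pM// rho0K.
    rewrite normrM mulrC ler_pM//.
    have -> : z - x = z - x0 - (x - x0) by ring.
    rewrite (le_trans (ler_normB _ _))// lerD ?(le_trans xx0)//.
    by rewrite (le_trans (ler_normB _ _))// mulr_natl mulr2n lerD.
  set a := Psi_n _ _ _ _ _ _ in lt diff; set b := Psi_n _ _ _ _ _ _ in diff *.
  have e2d : K * (C * delta n) <= e / 2.
    by rewrite mulrA mulrC -ler_pdivlMr// mulr_gt0.
  have := ler_distD b a (Psi s (eta0 s) rho0 theta).
  by rewrite [e]splitr in lt; lra.
split; last first.
  move=> cPsi theta_hat hatT root.
  exact: (consistent_of_uniform cTheta cPsi uniq hatT unif root).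
apply/cvg0_outerP => e e0; apply: vanishing_sub (unif e e0) _.
exists 0%N => n _ w /= /ereal_sup_gt[_ [theta Tth <-]]; rewrite lte_fin => lt.
by exists theta.
Qed.
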